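(* Let $\Omega \subset \mathbb{S}^{d-1}$ and $\sigma = \mathcal{H}^2|_{\Omega}$. Let $m\ge 1$ be an integer and assume $\Omega = \bigcup_{i=1}^{2m} S_i$, where: 1. for $i=1,\dots,2m$, $S_i$ is a 2-sphere of radius $\frac{1}{\sqrt{2m}}$ and center $\xi_i$; 2. there is a linear 3-plane $V \subset \mathbb{R}^d$ such that for all $i=1,\dots,2m$, $S_i \subset V+\xi_i$ and $\xi_i \in V^{\perp}$; 3. $\{\xi_i\}_{i=1}^{2m}$ is a distance symmetric set of points in $V^{\perp}$. Then $$\sigma(B(x,r)) = \pi r^2 \quad \text{for all } x \in \Omega \text{ and all } 0 \le r \le 2 .$$
   Context: $\mathbb{S}^{d-1}$ is the unit sphere of $\mathbb{R}^d$; $\mathcal{H}^2$ is 2-dimensional Hausdorff measure; $B(x,r)$ is the Euclidean ball. A 2-sphere of center $\xi$ and radius $\rho$ contained in $V+\xi$ ($V$ a linear 3-plane) is the set $\{z\in V+\xi : |z-\xi|=\rho\}$. Layering: let $N\ge1$. A layering is a family $\mathcal{L}=\{l_i\}_{i=0}^{N-1}$ of permutations of $\{1,\dots,N\}$ such that (1) $l_0(j)=j$ for all $j$; (2) $l_i(1)=i+1$ for all $i$; (3) for all $i\ne k$ and all $j$, $l_i(j)\neq l_k(j)$; (4) $l_i^{-1}=l_i$ for all $i$. Distance symmetry: a set $\{\alpha_1,\dots,\alpha_N\}$ of points in Euclidean space is $r$-distance symmetric ($r>0$) if there is a layering $\{l_i\}_{i=0}^{N-1}$ such that $|\alpha_j-\alpha_{l_i(j)}|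 = 2\sqrt{i}\,r$ for all $j\in\{1,\dots,N\}$ and $i\in\{0,\dots,N-1\}$. It is distance symmetric if this holds with $r = \frac{1}{\sqrt{N}}$. *)

(* Defs.v *)
From HB Require Import structures.
From mathcomp Require Import all_boot all_order all_algebra all_fingroup.
From mathcomp Require Import all_classical all_reals all_analysis.

Set Implicit Arguments.
Unset Strict Implicit.
Unset Printing Implicit Defensive.

Import Order.TTheory GRing.Theory Num.Theory.
Import numFieldNormedType.Exports.

Local Open Scope classical_set_scope.
Local Open Scope ring_scope.

Section Euclidean.
Context {R : realType} {d : nat}.
Implicit Types (u v x xi : 'rV[R]_d) (A S : set 'rV[R]_d).

Definition dotp u v : R := \sum_(i < d) u 0 i * v 0 i.

(* The canonical norm `|u| on 'rV[R]_d is the sup norm, hence the need for a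
   separate Euclidean norm. *)
Definition enorm u : R := Num.sqrt (dotp u u).

Definition unit_sphere : set 'rV[R]_d := [set x | enorm x = 1].

Definition orthogonal_compl (V : {vspace 'rV[R]_d}) : set 'rV[R]_d :=
  [set x | forall v, v \in V -> dotp v x = 0].

Definition affine_translate (V : {vspace 'rV[R]_d}) xi : set 'rV[R]_d :=
  [set z | z - xi \in V].

Definition is_2sphere S xi (rho : R) : Prop :=
  exists W : {vspace 'rV[R]_d},
    \dim W = 3%N /\
    S = [set z | affine_translate W xi z /\ enorm (z - xi) = rho].

(* Adjoining 0 makes the diameter of the empty set 0 rather than -oo. *)
Definition diam A : \bar R :=
  ereal_sup (0%E |` [set (enorm (p.1 - p.2))%:E | p in A `*` A]).

Definition delta_cover (delta : R) A : set (nat -> set 'rV[R]_d) :=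
  [set F | A `<=` \bigcup_i F i /\ forall i, (diam (F i) <= delta%:E)%E].

(* The factor pi / 4 is the area of the unit disc over 2 ^ 2: it normalizes
   the measure so that it agrees with Lebesgue measure on 2-planes. *)
Definition hausdorff2_delta (delta : R) A : \bar R :=
  ereal_inf [set (\sum_(i <oo) (pi / 4)%:E * (diam (F i) * diam (F i)))%E
            | F in delta_cover delta A].

(* hausdorff2_delta is nonincreasing in delta, so this supremum is the limit as
   delta tends to 0 from above. *)
Definition hausdorff2 A : \bar R :=
  ereal_sup [set hausdorff2_delta delta A | delta in [set e : R | 0 < e]].

(* Outer measures are restricted to arbitrary sets, whereas mrestr requires a
   measurable one. *)
Definition restriction (mu : set 'rV[R]_d -> \bar R) A : set 'rV[R]_d -> \bar R :=
  fun B => mu (B `&` A).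

End Euclidean.

(* 'I_N stands for {1, ..., N} when it indexes points, j : 'I_N being the label
   j + 1; layers are indexed from 0. The condition l_i(1) = i + 1 thus reads
   l i 0 = i. *)
Definition layering (N : nat) (l : 'I_N -> 'S_N) : Prop :=
  [/\ forall i j : 'I_N, i = 0%N :> nat -> l i j = j,
      forall i j : 'I_N, j = 0%N :> nat -> l i j = i,
      forall i k : 'I_N, i <> k -> forall j, l i j <> l k j
    & forall i : 'I_N, ((l i)^-1)%g = l i].

Section DistanceSymmetry.
Context {R : realType} {d : nat}.

Definition r_distance_symmetric (N : nat) (r : R) (A : set 'rV[R]_d) : Prop :=
  exists alpha : 'I_N -> 'rV[R]_d,
    A = range alpha /\
    exists l : 'I_N -> 'S_N, layering l /\
      forall i j : 'I_N,
        enorm (alpha j - alpha (l i j)) = 2 * Num.sqrt (i : nat)%:R * r.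

Definition distance_symmetric (N : nat) (A : set 'rV[R]_d) : Prop :=
  r_distance_symmetric N (1 / Num.sqrt N%:R) A.

End DistanceSymmetry.

(* Main.v *)
Require Import Defs.
From HB Require Import structures.
From mathcomp Require Import all_boot all_order all_algebra all_fingroup.
From mathcomp Require Import all_classical all_reals all_analysis.
From mathcomp Require Import measurable_realfun ring lra.

Set Implicit Arguments.
Unset Strict Implicit.
Unset Printing Implicit Defensive.

Import Order.TTheory GRing.Theory Num.Theory.
Import numFieldNormedType.Exports.

Local Open Scope classical_set_scope.
Local Open Scope ring_scope.

(* Write [N = 2 m], [rho = 1 / sqrt N], and let [x = xi_j + v] be a point of [S_j].
   All the spheres are translates of one another, so the ball [B(x, r)] meets
   [S_k] in a spherical cap centered at [xi_k + v], of squared chordal radius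
   [r^2 - |xi_j - xi_k|^2]; by Archimedes such a cap of chordal radius [s] has
   area [pi s^2]. Distance symmetry says that the numbers [|xi_j - xi_k|^2] are
   exactly [4 i rho^2] for [0 <= i < N], so the [i]-th cap contributes
   [pi (min (r^2, 4 (i + 1) rho^2) - min (r^2, 4 i rho^2))], and the sum
   telescopes to [pi r^2].

   The area of a cap is computed from the definition of the Hausdorff measure.
   Lower bound: in cylinder coordinates, which preserve area, every small piece
   of a cover is almost isometric to a planar set, whose area is controlled by
   the isodiametric inequality. Upper bound: in a thin strip the same chart is
   almost 1-Lipschitz, and a square is filled, up to repeated subdivision, by
   inscribed discs, for which [pi / 4 * diam ^ 2] is the area. *)

(** * Hausdorff measure *)

(** The sets of a cover are arbitrary, so the argument on the spheres uses outer-measure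
    inequalities only. Measurability enters in the plane, where a piece is replaced by a measurable
    hull obeying the same diameter bound, and additivity over the spheres comes from their mutual
    distance, at least [2 rho]. The chart has two defects. It degenerates at the poles, which are
    cut off in caps whose area is at most linear in their height. It also tears the sphere along a
    meridian, where nearby points have distant angles; angles within [eta] of this seam are dropped
    for the lower bound. The repeated subdivision of a square is not carried out: the least
    admissible constant satisfies an inequality that already forces its value. The range of [r] is
    what the [N] spheres can fill: their total area is [4 pi rho^2 N = 4 pi], which is [pi r^2] at
    [r = 2]. *)

Section Euclid.
Context {R : realType} {d : nat}.
Implicit Types (u v w x y : 'rV[R]_d) (A B : set 'rV[R]_d).

Lemma dotpC u v : dotp u v = dotp v u.
Proof. by apply: eq_bigr => i _; rewrite mulrC. Qed.

Lemma dotpDl u v w : dotp (u + v) w = dotp u w + dotp v w.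
Proof. by rewrite -big_split; apply: eq_bigr => i _; rewrite mxE mulrDl. Qed.

Lemma dotpZl a u w : dotp (a *: u) w = a * dotp u w.
Proof. by rewrite mulr_sumr; apply: eq_bigr => i _; rewrite mxE mulrA. Qed.

Lemma dotpNl u w : dotp (- u) w = - dotp u w.
Proof. by rewrite -scaleN1r dotpZl mulN1r. Qed.

Lemma dotpBl u v w : dotp (u - v) w = dotp u w - dotp v w.
Proof. by rewrite dotpDl dotpNl. Qed.

Lemma dotpDr u v w : dotp w (u + v) = dotp w u + dotp w v.
Proof. by rewrite !(dotpC w) dotpDl. Qed.

Lemma dotpZr a u w : dotp w (a *: u) = a * dotp w u.
Proof. by rewrite !(dotpC w) dotpZl. Qed.

Lemma dotpNr u w : dotp w (- u) = - dotp w u.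
Proof. by rewrite !(dotpC w) dotpNl. Qed.

Lemma dotpBr u v w : dotp w (u - v) = dotp w u - dotp w v.
Proof. by rewrite !(dotpC w) dotpBl. Qed.

Lemma dotp0l w : dotp 0 w = 0.
Proof. by rewrite -(scale0r 0) dotpZl mul0r. Qed.

Lemma dotp_ge0 u : 0 <= dotp u u.
Proof. by apply: sumr_ge0 => i _; rewrite -expr2 sqr_ge0. Qed.

Lemma dotp_eq0 u : (dotp u u == 0) = (u == 0).
Proof.
apply/eqP/eqP => [/eqP|->]; last by rewrite dotp0l.
rewrite psumr_eq0 => [/allP u0|i _]; last by rewrite -expr2 sqr_ge0.
apply/rowP => i; rewrite mxE.
by have /u0 := mem_index_enum i; rewrite /= mulf_eq0 orbb => /eqP.
Qed.

Lemma enorm_ge0 u : 0 <= enorm u. Proof. exact: sqrtr_ge0. Qed.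

Lemma enorm_sqr u : enorm u ^+ 2 = dotp u u.
Proof. by rewrite sqr_sqrtr ?dotp_ge0. Qed.

Lemma enorm_le u (s : R) : 0 <= s -> (enorm u <= s) = (dotp u u <= s ^+ 2).
Proof. by move=> s0; rewrite -enorm_sqr ler_pXn2r// nnegrE enorm_ge0. Qed.

Lemma enorm_eq u (s : R) : 0 <= s -> (enorm u = s) <-> (dotp u u = s ^+ 2).
Proof.
move=> s0; rewrite -enorm_sqr; split=> [->//|/eqP].
by rewrite eqrXn2 ?enorm_ge0// => /eqP.
Qed.

Lemma diam_le A (s : R) : 0 <= s ->
  (forall x y, A x -> A y -> enorm (x - y) <= s) -> (diam A <= s%:E)%E.
Proof.
move=> s0 As; apply: ge_ereal_sup => _ [->|[[x y] [/= Ax Ay] <-]].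
  by rewrite lee_fin.
by rewrite lee_fin As.
Qed.

Lemma diam_ge0 A : (0 <= diam A)%E.
Proof. by apply: ereal_sup_ubound; left. Qed.

Lemma le_diam A x y : A x -> A y -> ((enorm (x - y))%:E <= diam A)%E.
Proof. by move=> Ax Ay; apply: ereal_sup_ubound; right; exists (x, y). Qed.

End Euclid.

Section Hausdorff.
Context {R : realType} {d : nat}.
Local Open Scope ereal_scope.
Implicit Types (A B : set 'rV[R]_d) (F G : nat -> set 'rV[R]_d).

Definition cover_weight F i : \bar R := (pi / 4)%:E * (diam (F i) * diam (F i)).

Lemma cover_weight_ge0 F i : 0 <= cover_weight F i.
Proof.
by rewrite /cover_weight !mule_ge0 ?diam_ge0// lee_fin divr_ge0// pi_ge0.
Qed.

Lemma nneseries_le (u : nat -> \bar R) (b : \bar R) : (forall i, 0 <= u i) ->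
  (forall n, \sum_(0 <= i < n) u i <= b) -> \sum_(i <oo) u i <= b.
Proof.
move=> u0 ub; apply: lime_le; first exact: is_cvg_nneseries.
exact: nearW.
Qed.

Lemma ereal_inf_addP (P Q : set (\bar R)) (x : \bar R) :
  (forall a, P a -> 0 <= a) -> (forall a, Q a -> 0 <= a) ->
  (forall a b, P a -> Q b -> x <= a + b) -> x <= ereal_inf P + ereal_inf Q.
Proof.
move=> P0 Q0 PQ.
have iP0 : 0 <= ereal_inf P by apply: le_ereal_inf_tmp.
have iQ0 : 0 <= ereal_inf Q by apply: le_ereal_inf_tmp.
have [->|Poo] := eqVneq (ereal_inf P) +oo.
  by rewrite addye ?leey// gt_eqF// (lt_le_trans _ iQ0)// ltNy0.
have [->|Qoo] := eqVneq (ereal_inf Q) +oo.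
  by rewrite addey ?leey// gt_eqF// (lt_le_trans _ iP0)// ltNy0.
have fP : ereal_inf P \is a fin_num by rewrite ge0_fin_numE// ltey.
have fQ : ereal_inf Q \is a fin_num by rewrite ge0_fin_numE// ltey.
apply/lee_addgt0Pr => e e0.
have e20 : (0 < e / 2)%R by rewrite divr_gt0.
have [a Pa ae] := lb_ereal_inf_adherent e20 fP.
have [b Qb be] := lb_ereal_inf_adherent e20 fQ.
rewrite (le_trans (PQ _ _ Pa Qb))// [in leRHS](splitr e) EFinD addeACA.
by rewrite leeD// ltW.
Qed.

Lemma hausdorff2_delta_ge0 (delta : R) A : 0 <= hausdorff2_delta delta A.
Proof.
apply: le_ereal_inf_tmp => _ [F _ <-]; apply: nneseries_ge0 => i _ _.
exact: cover_weight_ge0.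
Qed.

Lemma le_hausdorff2_delta (delta : R) A B : A `<=` B ->
  hausdorff2_delta delta A <= hausdorff2_delta delta B.
Proof.
move=> AB; apply: le_ereal_inf_tmp => _ [F [BF Fd] <-].
apply: ereal_inf_lbound; exists F => //; split => //.
exact: subset_trans BF.
Qed.

Lemma hausdorff2_delta_nincr (e1 e2 : R) A : (e1 <= e2)%R ->
  hausdorff2_delta e2 A <= hausdorff2_delta e1 A.
Proof.
move=> e12; apply: le_ereal_inf_tmp => _ [F [AF Fd] <-].
apply: ereal_inf_lbound; exists F => //; split => // i.
by rewrite (le_trans (Fd i))// lee_fin.
Qed.

(** [A] itself, followed by empty sets, is a cover; the empty sets cost nothing because their
    diameter is 0. *)
Lemma hausdorff2_delta_le_sqr (delta s : R) A : (0 <= s <= delta)%R ->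
  (forall x y, A x -> A y -> (enorm (x - y) <= s)%R) ->
  hausdorff2_delta delta A <= (pi / 4 * s ^+ 2)%:E.
Proof.
move=> /andP[s0 sd] As; pose F (i : nat) : set 'rV[R]_d := if i is 0%N then A else set0.
have diam0 : diam (set0 : set 'rV[R]_d) = 0.
  by apply/eqP; rewrite eq_le diam_ge0 andbT; apply: diam_le.
have dF i : diam (F i) <= delta%:E.
  case: i => [|i] /=; last by rewrite diam0 lee_fin (le_trans s0).
  by rewrite (le_trans (diam_le s0 As))// lee_fin.
apply: (@le_trans _ _ (\sum_(i <oo) cover_weight F i)).
  apply: ereal_inf_lbound; exists F => //; split => //.
  by move=> x Ax; exists 0%N.
apply: nneseries_le => [i|[|n]]; first exact: cover_weight_ge0.
  by rewrite big_geq// lee_fin mulr_ge0 ?sqr_ge0// divr_ge0// pi_ge0.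
rewrite big_nat_recl// big1 ?adde0 => [|i _].
  rewrite /cover_weight/= (EFinM (pi / 4)); apply: lee_pmul => //.
  - by rewrite lee_fin divr_ge0// pi_ge0.
  - by rewrite mule_ge0 ?diam_ge0.
  - by rewrite expr2 EFinM; apply: lee_pmul; rewrite ?diam_ge0//; exact: diam_le.
by rewrite /cover_weight/= diam0 !mule0.
Qed.

Lemma hausdorff2_delta0 (delta : R) : (0 <= delta)%R ->
  hausdorff2_delta delta (set0 : set 'rV[R]_d) = 0.
Proof.
move=> d0; apply/eqP; rewrite eq_le hausdorff2_delta_ge0 andbT.
have := @hausdorff2_delta_le_sqr delta 0 set0.
by rewrite lexx d0 expr0n/= mulr0; apply.
Qed.

Lemma hausdorff2_deltaU (delta : R) A B :
  hausdorff2_delta delta (A `|` B) <=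
  hausdorff2_delta delta A + hausdorff2_delta delta B.
Proof.
have w0 C a : [set (\sum_(i <oo) cover_weight F i) | F in delta_cover delta C] a ->
    0 <= a.
  by move=> [F _ <-]; apply: nneseries_ge0 => i _ _; exact: cover_weight_ge0.
apply: ereal_inf_addP; [exact: w0|exact: w0|].
move=> _ _ [F [AF Fd] <-] [G [BG Gd] <-].
(* The two covers are interleaved, so that the first [2 n] terms of the new series are the first [n]
   terms of each. *)
pose K n := if odd n then G n./2 else F n./2.
apply: (@le_trans _ _ (\sum_(i <oo) cover_weight K i)).
  apply: ereal_inf_lbound; exists K => //; split.
    move=> x [/AF[i _ Fx]|/BG[i _ Gx]].
      by exists i.*2 => //; rewrite /K odd_double doubleK.
    by exists i.*2.+1 => //; rewrite /K /= odd_double/= uphalf_double.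
  by move=> i; rewrite /K; case: ifP.
apply: nneseries_le => [i|n]; first exact: cover_weight_ge0.
have KFG m : \sum_(0 <= i < m.*2) cover_weight K i =
    \sum_(0 <= i < m) cover_weight F i + \sum_(0 <= i < m) cover_weight G i.
  elim: m => [|m IH]; first by rewrite !big_geq// adde0.
  rewrite doubleS !big_nat_recr//= IH -addeA addeACA; congr (_ + (_ + _)).
    by rewrite /cover_weight /K odd_double doubleK.
  by rewrite /cover_weight /K /= odd_double/= uphalf_double.
apply: (@le_trans _ _ (\sum_(0 <= i < n.*2) cover_weight K i)).
  apply: lee_sum_nneg_natr => [i _ _|]; first exact: cover_weight_ge0.
  by rewrite -addnn leq_addr.
by rewrite KFG leeD//; apply: nneseries_lim_ge => i _ _; exact: cover_weight_ge0.
Qed.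

Lemma hausdorff2_delta_bigU (delta : R) (I : finType) (P : pred I)
    (A : I -> set 'rV[R]_d) B : (0 <= delta)%R ->
  B `<=` \bigcup_(i in [set i | P i]) A i ->
  hausdorff2_delta delta B <= \sum_(i | P i) hausdorff2_delta delta (A i).
Proof.
move=> d0 /(@le_hausdorff2_delta delta)/le_trans; apply.
rewrite bigcup_pred.
elim/big_rec2: _ => [|i y C _ IH]; first by rewrite hausdorff2_delta0.
by rewrite (le_trans (hausdorff2_deltaU _ _ _))// leeD2l.
Qed.

(** A set of diameter at most [delta] cannot meet both [A] and [B], so a cover of the union splits
    into a cover of each, the irrelevant sets being replaced by [set0]. *)
Lemma hausdorff2_delta_separated (delta eta : R) A B : (delta < eta)%R ->
  (forall x y, A x -> B y -> (eta <= enorm (x - y))%R) ->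
  hausdorff2_delta delta A + hausdorff2_delta delta B <=
  hausdorff2_delta delta (A `|` B).
Proof.
move=> de AB; apply: le_ereal_inf_tmp => _ [F [ABF Fd] <-].
have d0 : (0 <= delta)%R.
  by rewrite -lee_fin (le_trans _ (Fd 0%N))// diam_ge0.
pose FA i := if pselect (F i `&` A !=set0) then F i else set0.
pose FB i := if pselect (F i `&` B !=set0) then F i else set0.
have diam0 : diam (set0 : set 'rV[R]_d) = 0.
  by apply/eqP; rewrite eq_le diam_ge0 andbT; apply: diam_le.
apply: (@le_trans _ _ (\sum_(i <oo) cover_weight FA i + \sum_(i <oo) cover_weight FB i)).
  apply: leeD; apply: ereal_inf_lbound.
    exists FA => //; split => [x Ax|i]; last first.
      by rewrite /FA; case: pselect => //= _; rewrite diam0 lee_fin.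
    have [i _ Fx] := ABF x (or_introl Ax); exists i => //.
    by rewrite /FA; case: pselect => // -[]; exists x.
  exists FB => //; split => [x Bx|i]; last first.
    by rewrite /FB; case: pselect => //= _; rewrite diam0 lee_fin.
  have [i _ Fx] := ABF x (or_intror Bx); exists i => //.
  by rewrite /FB; case: pselect => // -[]; exists x.
rewrite -nneseriesD; [|by move=> i _ _; exact: cover_weight_ge0..].
apply: lee_nneseries => [i _ _|i _].
  by rewrite adde_ge0 ?cover_weight_ge0.
rewrite /cover_weight /FA /FB.
case: pselect => [[x [Fx Ax]]|nA] /=; case: pselect => [[y [Fy By]]|nB] /=;
  rewrite ?diam0 ?mule0 ?adde0 ?add0e//; last first.
  exact: cover_weight_ge0.
have := le_trans (le_diam Fx Fy) (Fd i).
by rewrite lee_fin => /(le_trans (AB _ _ Ax By)); rewrite leNgt de.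
Qed.

Lemma hausdorff2_ge (delta : R) A : (0 < delta)%R ->
  hausdorff2_delta delta A <= hausdorff2 A.
Proof. by move=> d0; apply: ereal_sup_ubound; exists delta. Qed.

Lemma hausdorff2_le A (b : \bar R) :
  (forall delta : R, (0 < delta)%R -> hausdorff2_delta delta A <= b) ->
  hausdorff2 A <= b.
Proof. by move=> Ab; apply: ge_ereal_sup => _ [e e0 <-]; exact: Ab. Qed.

Lemma hausdorff2_ge0 A : 0 <= hausdorff2 A.
Proof.
exact: le_trans (hausdorff2_delta_ge0 _ _) (hausdorff2_ge A (@ltr01 R)).
Qed.

Lemma le_hausdorff2 A B : A `<=` B -> hausdorff2 A <= hausdorff2 B.
Proof.
move=> AB; apply: hausdorff2_le => e e0.
exact: le_trans (le_hausdorff2_delta _ AB) (hausdorff2_ge _ e0).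
Qed.

Lemma hausdorff2_bigU (I : finType) (P : pred I) (A : I -> set 'rV[R]_d) B :
  B `<=` \bigcup_(i in [set i | P i]) A i ->
  hausdorff2 B <= \sum_(i | P i) hausdorff2 (A i).
Proof.
move=> BA; apply: hausdorff2_le => e e0.
rewrite (le_trans (hausdorff2_delta_bigU (ltW e0) BA))//.
by apply: lee_sum => i _; exact: hausdorff2_ge.
Qed.

Lemma hausdorff2U A B : hausdorff2 (A `|` B) <= hausdorff2 A + hausdorff2 B.
Proof.
apply: hausdorff2_le => e e0; rewrite (le_trans (hausdorff2_deltaU _ _ _))//.
by rewrite leeD// hausdorff2_ge.
Qed.

(** The two suprema may be approached at different scales. Both are moved to one common scale below
    [eta], where covers split; refining the scale only increases the values. *)
Lemma hausdorff2_separated (eta : R) A B : (0 < eta)%R ->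
  (forall x y, A x -> B y -> (eta <= enorm (x - y))%R) ->
  hausdorff2 A + hausdorff2 B <= hausdorff2 (A `|` B).
Proof.
move=> eta0 AB.
have key (e1 e2 : R) : (0 < e1)%R -> (0 < e2)%R ->
    hausdorff2_delta e1 A + hausdorff2_delta e2 B <= hausdorff2 (A `|` B).
  move=> e10 e20; pose e := Num.min (Num.min e1 e2) (eta / 2)%R.
  have e0 : (0 < e)%R by rewrite !lt_min e10 e20 divr_gt0.
  have ee1 : (e <= e1)%R by rewrite !ge_min lexx.
  have ee2 : (e <= e2)%R by rewrite !ge_min lexx orbT.
  have ee : (e < eta)%R.
    by rewrite gt_min ltr_pdivrMr// ltr_pMr// ltr1n orbT.
  apply: (@le_trans _ _ (hausdorff2_delta e A + hausdorff2_delta e B)).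
    by apply: leeD; exact: hausdorff2_delta_nincr.
  apply: le_trans (hausdorff2_ge _ e0).
  exact: hausdorff2_delta_separated AB.
have [AB_oo|AB_fin] := eqVneq (hausdorff2 (A `|` B)) +oo.
  by rewrite AB_oo leey.
have hAB C : C `<=` A `|` B -> hausdorff2 C \is a fin_num.
  move=> CAB; rewrite ge0_fin_numE ?hausdorff2_ge0//.
  by rewrite (le_lt_trans (le_hausdorff2 CAB))// ltey.
have fA := hAB A (@subsetUl _ _ _).
have fB := hAB B (@subsetUr _ _ _).
apply/lee_addgt0Pr => e e0.
have e20 : (0 < e / 2)%R by rewrite divr_gt0.
have [_ [e1 e10 <-] Ae] := ub_ereal_sup_adherent e20 fA.
have [_ [e2 e2_0 <-] Be] := ub_ereal_sup_adherent e20 fB.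
have /= := key _ _ e10 e2_0; rewrite -(leeD2rE _ _ (_ : e%:E \is a fin_num))//.
apply: le_trans; rewrite [in leRHS](splitr e) EFinD addeACA.
by apply: leeD; rewrite -leeBlDr//; exact: ltW.
Qed.

(** Positive distance takes the place of measurability: this is how the measures on the separate
    spheres are summed. *)
Lemma hausdorff2_bigU_separated (eta : R) (I : finType) (A : I -> set 'rV[R]_d) :
  (0 < eta)%R ->
  (forall i j x y, i != j -> A i x -> A j y -> (eta <= enorm (x - y))%R) ->
  hausdorff2 (\bigcup_(i in [set: I]) A i) = \sum_i hausdorff2 (A i).
Proof.
move=> eta0 Aeta; apply/eqP; rewrite eq_le; apply/andP; split.
  by apply: hausdorff2_bigU => x [i _ Aix]; exists i.
suff gen s : uniq s ->
    \sum_(i <- s) hausdorff2 (A i) <= hausdorff2 (\bigcup_(i in [set` s]) A i).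
  have := gen _ (enum_uniq I); rewrite big_enum/= => /le_trans; apply.
  by apply: le_hausdorff2; exact: bigcup_subset.
elim: s => [|i s IH] /=; first by rewrite big_nil hausdorff2_ge0.
move=> /andP[iNs us]; rewrite bigcup_seq !big_cons.
apply: le_trans (hausdorff2_separated eta0 _); first by rewrite leeD2l// -bigcup_seq IH.
move=> x y Aix; rewrite -bigcup_seq => -[j /= js]; apply: (Aeta i) => //.
by apply: contraNneq iNs => ->.
Qed.

End Hausdorff.

(** * Planar Lebesgue measure and the isodiametric inequality *)

Section Semicircle.
Context {R : realType}.
Notation mu := (@lebesgue_measure R).

(** The substitution [t = T sin u] leads to the antiderivative [T^2 / 2 (u + sin u cos u)]. The
    endpoints in use are those of a quarter disc, for the isodiametric inequality, and of a half
    disc, for the area of a disc. *)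
Lemma integral_semicircle (T a b : R) : 0 < T -> - (pi / 2) <= a ->
  a <= b -> b <= pi / 2 ->
  (\int[mu]_(t in `[(T * sin a)%R, (T * sin b)%R]) (Num.sqrt (T ^+ 2 - t ^+ 2))%:E =
   (T ^+ 2 / 2 * (b - a + sin b * cos b - sin a * cos a))%:E)%E.
Proof.
move=> T0 pa; rewrite le_eqVlt => /predU1P[<- _|ab bp].
  by rewrite set_itv1 integral_set1; congr EFin; lra.
have dF (x : R) : is_derive x 1 (fun u : R => T * sin u) (T * cos x).
  by apply: is_derive_eq; rewrite /GRing.scale/=.
have cF : continuous (fun u : R => T * sin u).
  by move=> x; apply: continuousM; [exact: cst_continuous|exact: continuous_sin].
have F' : derive1 (fun u : R => T * sin u) = (fun u => T * cos u).
  by apply/funext => x; rewrite derive1E derive_val.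
have cF' : continuous (fun u : R => T * cos u).
  by move=> x; apply: continuousM; [exact: cst_continuous|exact: continuous_cos].
rewrite (@integration_by_substitution_increasing R (fun u => T * sin u)
  (fun t => Num.sqrt (T ^+ 2 - t ^+ 2)) a b (ltW ab)); last first.
- apply: continuous_subspaceT => x.
  apply: (@continuous_comp _ _ _ (fun t : R => T ^+ 2 - t ^+ 2)).
    by apply: continuousB; [exact: cst_continuous|exact: exprn_continuous].
  exact: sqrt_continuous.
- split; first by move=> x _; exact: ex_derive.
    by apply: cvg_at_right_filter; exact: cF.
  by apply: cvg_at_left_filter; exact: cF.
- rewrite F'; apply/cvg_ex; exists (T * cos b).
  by apply: cvg_at_left_filter; exact: cF'.
- rewrite F'; apply/cvg_ex; exists (T * cos a).
  by apply: cvg_at_right_filter; exact: cF'.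
- by rewrite F' => x _; exact: cF'.
- move=> x y; rewrite !in_itv/= => /andP[ax xb] /andP[ay yb] xy.
  rewrite ltr_pM2l// ltr_sin// in_itv/= ?(le_trans pa)//=; lra.
transitivity (\int[mu]_(x in `[a, b]) (T ^+ 2 * cos x ^+ 2)%:E)%E.
  apply: eq_integral => x; rewrite inE/= in_itv/= => /andP[ax xb].
  rewrite F'; congr EFin.
  change (Num.sqrt (T ^+ 2 - (T * sin x) ^+ 2) * (T * cos x) = T ^+ 2 * cos x ^+ 2).
  have c0 : 0 <= cos x by apply: cos_ge0_pihalf; lra.
  have -> : T ^+ 2 - (T * sin x) ^+ 2 = (T * cos x) ^+ 2.
    by rewrite !exprMn sin2cos2; ring.
  by rewrite sqrtr_sqr ger0_norm ?mulr_ge0 ?(ltW T0)//; ring.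
pose P (u : R) : R := T ^+ 2 / 2 * (u + sin u * cos u).
have dP (x : R) : is_derive x 1 P (T ^+ 2 * cos x ^+ 2).
  apply: is_derive_eq.
  rewrite /GRing.scale/= mulrN -[sin x * _]expr2 sin2cos2; by field.
have cP : continuous P.
  move=> x; apply: differentiable_continuous.
  by apply/derivable1_diffP; exact: ex_derive.
rewrite (@continuous_FTC2 R _ P a b ab).
- by rewrite -EFinB /P; congr EFin; field.
- apply: continuous_subspaceT => x; apply: differentiable_continuous.
  by apply/derivable1_diffP; exact: ex_derive.
- split; first by move=> x _; exact: ex_derive.
    by apply: cvg_at_right_filter; exact: cP.
  by apply: cvg_at_left_filter; exact: cP.
- by move=> x _; rewrite derive1E derive_val.
Qed.

End Semicircle.

Section Isodiametric.
Context {R : realType}.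
Notation mu := (@lebesgue_measure R).
Notation leb2 := (@lebesgue_measure R \x @lebesgue_measure R)%E.
Notation plane := (R * R)%type.

Lemma lebesgue_measure_le_itv (A : set (R)) (a b : R) : measurable A ->
  a <= b -> A `<=` `[a, b] -> (mu A <= (b - a)%:E)%E.
Proof.
move=> mA ab Aab.
apply: (@le_trans _ _ (mu (`[a, b]%classic : set (R)))).
  by apply: le_measure; rewrite ?inE//; exact: measurable_itv.
by rewrite lebesgue_measure_itv/= lte_fin; case: ltP => // _; rewrite lee_fin subr_ge0.
Qed.

(** [Y] lies in [[inf Y, sup Y]], hence [X] in [[sup Y - tau, inf Y + tau]], and the two lengths add
    up to [2 tau]. *)
Lemma lebesgue_measure_pair (X Y : set (R)) (tau : R) :
  measurable X -> measurable Y -> X !=set0 -> Y !=set0 ->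
  (forall x y, X x -> Y y -> `|x - y| <= tau) ->
  (mu X + mu Y <= (2 * tau)%:E)%E.
Proof.
move=> mX mY [x0 Xx0] [y0 Yy0] XY.
have Yub x : X x -> ubound Y (x + tau).
  by move=> Xx y /(XY _ _ Xx); rewrite ler_norml => /andP[]; lra.
have Ylb x : X x -> lbound Y (x - tau).
  by move=> Xx y /(XY _ _ Xx); rewrite ler_norml => /andP[]; lra.
have supY : has_sup Y by split; [exists y0|exists (x0 + tau); exact: Yub].
have infY : has_inf Y by split; [exists y0|exists (x0 - tau); exact: Ylb].
have YE y : Y y -> inf Y <= y <= sup Y.
  by move=> Yy; rewrite ge_inf ?ub_le_sup//; [case: supY|case: infY].
have XE x : X x -> sup Y - tau <= x <= inf Y + tau.
  move=> Xx; rewrite lerBlDr ge_sup//=; [|by exists y0|exact: Yub].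
  by rewrite -lerBlDr lb_le_inf//; [exists y0|exact: Ylb].
apply: (@le_trans _ _ ((inf Y + tau - (sup Y - tau))%:E + (sup Y - inf Y)%:E)%E).
  apply: leeD; apply: lebesgue_measure_le_itv => //.
  - by have /andP[h1 h2] := XE _ Xx0; exact: le_trans h2.
  - by have /andP[h1 h2] := YE _ Yy0; exact: le_trans h2.
by rewrite -EFinD lee_fin; lra.
Qed.

(** Both sides are the area of [U], the region between the axis and the graph of [g], computed by
    vertical and by horizontal sections. *)
Lemma layer_cake (g : R -> \bar R) : measurable_fun [set: R] g ->
  (forall x, 0 <= g x)%E ->
  (\int[mu]_x g x = \int[mu]_(t in `[0%R, +oo[) mu [set x | t%:E < g x])%E.
Proof.
move=> mg g0.
pose U : set plane := [set p | 0 <= p.2] `&` [set p | (p.2%:E < g p.1)%E].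
have mU : measurable U.
  apply: measurableI.
    rewrite (_ : [set _ | _] = setT `*` `[0, +oo[%classic).
      by apply: measurableX => //; exact: measurable_itv.
    by apply/seteqP; split => -[x y] /=; rewrite in_itv/= andbT; [|case].
  rewrite -[X in measurable X]setTI; apply: measurable_lte => //.
    by apply/measurable_EFinP; exact: measurable_snd.
  by apply: measurableT_comp => //; exact: measurable_fst.
have := @indic_fubini_tonelli _ _ _ _ _ mu mu U mU.
rewrite indic_fubini_tonelli_FE// indic_fubini_tonelli_GE// => UE.
transitivity (\int[mu]_x (mu \o xsection U) x)%E.
  apply: eq_integral => x _ /=.
  have -> : xsection U x = [set t | 0 <= t /\ (t%:E < g x)%E].
    by apply/seteqP; split => t /=; rewrite xsectionP.
  have := g0 x; case: (g x) => [r| |] // r0.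
    rewrite (_ : [set _ | _] = `[0, r[%classic); last first.
      apply/seteqP; split => t /=; rewrite in_itv/= lte_fin; first by move=> [-> ->].
      by move=> /andP[].
    rewrite lebesgue_measure_itv/= lte_fin; case: ltgtP => [_|r1|<-]//.
      by rewrite EFinN sube0.
    by move: r0; rewrite lee_fin leNgt r1.
  rewrite (_ : [set _ | _] = `[0, +oo[%classic).
    by rewrite lebesgue_measure_itv/= ltry.
  by apply/seteqP; split => t /=; rewrite in_itv/= andbT ltry//; case.
rewrite UE [RHS]integral_mkcond; apply: eq_integral => t _ /=.
rewrite patchE; case: ifPn; rewrite ?inE/= ?notin_setE/= in_itv/= andbT => t0.
  congr (mu _); apply/seteqP; split => x /=; rewrite ysectionP/U/=; first by case.
  by [].
rewrite (_ : ysection _ _ = set0) ?measure0//.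
by rewrite -subset0 => x; rewrite ysectionP => -[].
Qed.

(** Let [g x] be the length of the vertical section at [x]. Two sections longer than [t] contain
    points at vertical distance at least about [t], so [g x, g x' > t] forces
    [(a (x - x'))^2 + (b t)^2 <= s^2]. Hence the set where [g > t] has length at most
    [b / a sqrt (T^2 - t^2)], and integrating over [t] gives a quarter disc of radius [T], scaled by
    [b / a]. *)
Lemma isodiametric_measurable (A : set plane) (a b s : R) :
  measurable A -> 0 < a -> 0 < b -> 0 <= s ->
  (forall p q, A p -> A q ->
    (a * (p.1 - q.1)) ^+ 2 + (b * (p.2 - q.2)) ^+ 2 <= s ^+ 2) ->
  (leb2 A <= (pi / 4 * s ^+ 2 / (a * b))%:E)%E.
Proof.
move=> mA a0 b0 s0 As; pose T := s / b.
have T0 : 0 <= T by rewrite divr_ge0// ltW.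
pose g : R -> \bar R := mu \o xsection A.
have mg : measurable_fun [set: R] g by exact: measurable_fun_xsection.
have -> : leb2 A = (\int[mu]_x g x)%E by [].
rewrite layer_cake => [|//|x]; last exact: measure_ge0.
have Et t x x' : 0 <= t -> (t%:E < g x -> t%:E < g x' ->
    ((a * (x - x')) ^+ 2 + (b * t) ^+ 2 <= s ^+ 2)%R)%E.
  move=> t0 gx gx'.
  have ne y : (t%:E < g y)%E -> xsection A y !=set0.
    move=> gy; apply/set0P; apply: contraTneq gy => y0.
    by rewrite /g/= y0 measure0 -leNgt lee_fin.
  have [y Axy] := ne _ gx; have [y' Axy'] := ne _ gx'.
  move: (Axy) (Axy'); rewrite !xsectionP => Ay Ay'.
  have D0 : 0 <= s ^+ 2 - (a * (x - x')) ^+ 2.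
    rewrite subr_ge0 (le_trans _ (As _ _ Ay Ay'))//= lerDl sqr_ge0//.
  pose tau := Num.sqrt (s ^+ 2 - (a * (x - x')) ^+ 2) / b.
  have tau0 : 0 <= tau by rewrite divr_ge0// ?sqrtr_ge0// ltW.
  have btau0 : 0 <= b * tau by rewrite mulr_ge0// ltW.
  have tauE : (b * tau) ^+ 2 = s ^+ 2 - (a * (x - x')) ^+ 2.
    by rewrite mulrC divfK ?gt_eqF// sqr_sqrtr.
  suff : t <= tau.
    move=> ttau; rewrite -lerBrDl -tauE ler_pXn2r ?nnegrE ?(mulr_ge0 (ltW b0) t0)//.
    by rewrite ler_pM2l.
  have := @lebesgue_measure_pair (xsection A x) (xsection A x') tau
    (measurable_xsection _ mA) (measurable_xsection _ mA) (ne _ gx) (ne _ gx').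
  have close z z' : xsection A x z -> xsection A x' z' -> `|z - z'| <= tau.
    rewrite !xsectionP => Az Az'.
    have := As _ _ Az Az'; rewrite /= -lerBrDl -tauE.
    rewrite -[leLHS]real_normK ?num_real// ler_pXn2r ?nnegrE ?normr_ge0//.
    by rewrite normrM gtr0_norm// ler_pM2l.
  move=> /(_ close) gg.
  have : ((t + t)%:E <= (2 * tau)%:E)%E.
    by rewrite EFinD (le_trans _ gg)// leeD// ltW.
  by rewrite lee_fin; lra.
have mt t : measurable ([set x | (t%:E < g x)%E] : set (R)).
  by rewrite -[X in measurable X]setTI; apply: measurable_lte.
have Emu t : 0 <= t -> (mu [set x | (t%:E < g x)%E] <=
    (if t <= T then b / a * Num.sqrt (T ^+ 2 - t ^+ 2) else 0)%:E)%E.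
  move=> t0; have [[x gx]|ne] := pselect ([set x | (t%:E < g x)%E] !=set0); last first.
    have -> : [set x | (t%:E < g x)%E] = set0.
      by apply/eqP; rewrite -[_ == _]negbK; apply/negP => /set0P.
    rewrite measure0 lee_fin; case: ifP => // _.
    by rewrite mulr_ge0 ?sqrtr_ge0// divr_ge0// ltW.
  have tT : t <= T.
    have := Et t x x t0 gx gx; rewrite subrr mulr0 expr0n/= add0r.
    rewrite ler_pXn2r ?nnegrE ?mulr_ge0 ?(ltW b0)// => bts.
    by rewrite /T ler_pdivlMr// mulrC.
  rewrite tT; set D := b / a * _.
  (* The superlevel set is paired with itself: points at mutual distance at most [D] occupy a length
     at most [D]. *)
  suff : (mu [set x | (t%:E < g x)%E] + mu [set x | (t%:E < g x)%E] <= (2 * D)%:E)%E.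
    move=> h; rewrite -(@lee_pmul2l _ 2%:E)// ?lte_fin//.
    by rewrite -EFinM (le_trans _ h)// mule_natl mule2n.
  apply: lebesgue_measure_pair => //; [by exists x|by exists x|].
  move=> z z' /= gz gz'; have := Et t z z' t0 gz gz'.
  rewrite -lerBrDr => h.
  have E : D = Num.sqrt (s ^+ 2 - (b * t) ^+ 2) / a.
    rewrite /D mulrAC; congr (_ * _).
    rewrite -{1}(gtr0_norm b0) -sqrtr_sqr -sqrtrM ?sqr_ge0//; congr Num.sqrt.
    by rewrite /T; field; rewrite gt_eqF.
  rewrite E ler_pdivlMr// mulrC -{1}(gtr0_norm a0) -normrM.
  by rewrite -sqrtr_sqr ler_wsqrtr.
apply: (@le_trans _ _ (\int[mu]_(t in `[0%R, +oo[)
    (if t <= T then b / a * Num.sqrt (T ^+ 2 - t ^+ 2) else 0)%:E)%E).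
  apply: ge0_le_integral => //.
  - apply: (measurable_funS measurableT) => //.
    pose U : set plane := [set p | (p.2%:E < g p.1)%E].
    have mU : measurable U.
      rewrite -[X in measurable X]setTI; apply: measurable_lte => //.
        by apply/measurable_EFinP; exact: measurable_snd.
      by apply: measurableT_comp => //; exact: measurable_fst.
    rewrite (_ : (fun _ => _) = mu \o ysection U).
      exact: measurable_fun_ysection.
    by apply/funext => t /=; congr (mu _); apply/seteqP; split => x; rewrite ysectionP.
  - apply: (measurable_funS measurableT) => //; apply/measurable_EFinP.
    apply: measurable_fun_ifT => //; first exact: measurable_fun_ler.
    apply: measurable_funM => //; apply: continuous_measurable_fun => x.
    apply: (@continuous_comp _ _ _ (fun t : R => T ^+ 2 - t ^+ 2)).
      by apply: continuousB; [exact: cst_continuous|exact: exprn_continuous].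
    exact: sqrt_continuous.
  - by move=> t; rewrite /= in_itv/= andbT => /Emu.
have -> : (\int[mu]_(t in `[0%R, +oo[)
    (if t <= T then b / a * Num.sqrt (T ^+ 2 - t ^+ 2) else 0)%:E =
    \int[mu]_(t in `[0%R, T]) ((b / a)%:E * (Num.sqrt (T ^+ 2 - t ^+ 2))%:E))%E.
  rewrite [LHS]integral_mkcond [RHS]integral_mkcond; apply: eq_integral => t _.
  rewrite !patchE !mem_setE !in_itv/= andbT.
  by case: (leP 0 t) => //= _; case: ifP.
rewrite ge0_integralZl//; last 2 first.
- apply/measurable_EFinP; apply: (measurable_funS measurableT) => //.
  apply: continuous_measurable_fun => x.
  apply: (@continuous_comp _ _ _ (fun t : R => T ^+ 2 - t ^+ 2)).
    by apply: continuousB; [exact: cst_continuous|exact: exprn_continuous].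
  exact: sqrt_continuous.

- by rewrite lee_fin divr_ge0// ltW.
have [T1|T1] := eqVneq T 0.
  rewrite T1 set_itv1 integral_set1 mule0 lee_fin.
  by rewrite divr_ge0 ?mulr_ge0 ?sqr_ge0 ?divr_ge0 ?pi_ge0 ?(ltW a0) ?(ltW b0).
have Tgt0 : 0 < T by rewrite lt0r T1.
have := @integral_semicircle R T 0 (pi / 2) Tgt0.
rewrite sin0 sin_pihalf cos_pihalf mulr0 mulr1 => ->; last 3 first.
- by rewrite oppr_le0 divr_ge0// pi_ge0.
- by rewrite divr_ge0// pi_ge0.
- by [].
rewrite -EFinM lee_fin le_eqVlt; apply/orP; left; apply/eqP.
by rewrite /T; field; rewrite !gt_eqF.
Qed.

End Isodiametric.

Section Plane.
Context {R : realType}.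
Notation mu := (@lebesgue_measure R).
Notation leb2 := (@lebesgue_measure R \x @lebesgue_measure R)%E.
Notation plane := (R * R)%type.

Lemma ler_invnP (x y K : R) : (forall n : nat, x <= y + K / n.+1%:R) -> x <= y.
Proof.
move=> h; apply/ler_addgt0Pr => e e0.
have [K0|K0] := leP K 0.
  by apply: le_trans (h 0%N) _; rewrite lerD2l divr1 (le_trans K0)// ltW.
pose n := Num.bound (K / e).
apply: le_trans (h n) _; rewrite lerD2l ler_pdivrMr// mulrC -ler_pdivrMr//.
have Ke : 0 <= K / e by rewrite divr_ge0// ltW.
by rewrite (le_trans (ltW (archi_boundP Ke)))// ler_nat.
Qed.

(** The hull is the intersection over [n] of the unions [B n] of those grid cells of side
    [1 / (n + 1)] that meet [A]. Each [B n] is measurable, and its points are so close to [A] that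
    the diameter bound survives in the limit. *)
Lemma isodiametric (A : set plane) (a b s : R) :
  0 < a -> 0 < b -> 0 <= s ->
  (forall p q, A p -> A q ->
    (a * (p.1 - q.1)) ^+ 2 + (b * (p.2 - q.2)) ^+ 2 <= s ^+ 2) ->
  exists B : set plane, [/\ measurable B, A `<=` B &
    (leb2 B <= (pi / 4 * s ^+ 2 / (a * b))%:E)%E].
Proof.
move=> a0 b0 s0 As.
pose fl n (p : plane) := (Num.floor (p.1 * n.+1%:R), Num.floor (p.2 * n.+1%:R)).
pose B n : set plane := [set q | exists2 p, A p & fl n q = fl n p].
have mcell n k : measurable ([set q | Num.floor (q * n.+1%:R) = k] : set R).
  rewrite (_ : [set _ | _] = `[k%:~R / n.+1%:R, (k + 1)%:~R / n.+1%:R[%classic).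
    exact: measurable_itv.
  apply/seteqP; split => x /=; rewrite in_itv/= ler_pdivrMr// ltr_pdivlMr//.
    by move=> <-; rewrite floor_le_tmp floorD1_gt.
  by move=> xk; apply: floor_def.
have mB n : measurable (B n).
  rewrite (_ : B n = \bigcup_(k : int * int)
      (if pselect (exists2 p, A p & fl n p = k) then
        [set q | Num.floor (q * n.+1%:R) = k.1] `*` [set q | Num.floor (q * n.+1%:R) = k.2]
       else set0)).
    apply: countable_bigcupT_measurable => // k.
    by case: pselect => //= _; apply: measurableX.
  apply/seteqP; split => [q [p Ap qp]|q [k _]].
    exists (fl n p) => //; case: pselect => [h|[]]; last by exists p.
    by case: qp => /= -> ->.
  case: pselect => [[p Ap kE]|h] //= -[h1 h2];
    by exists p => //; rewrite kE [k]surjective_pairing -h1 -h2.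
exists (\bigcap_n B n); split.
- by apply: bigcapT_measurable.
- by move=> p Ap n _; exists p.
apply: isodiametric_measurable => //; first exact: bigcapT_measurable.
move=> p q Bp Bq; set x := p.1 - q.1; set y := p.2 - q.2.
(* Moving both points into [A] changes each coordinate difference [u] by at most [2 / (n + 1)],
   hence lowers [u^2] by at most [4 |u| / (n + 1)]. *)
apply: (@ler_invnP _ _ (4 * (a ^+ 2 * `|x| + b ^+ 2 * `|y|))) => n.
have [p' Ap' [p1 p2]] := Bp n Logic.I; have [q' Aq' [q1 q2]] := Bq n Logic.I.
have near (u v : R) : Num.floor (u * n.+1%:R) = Num.floor (v * n.+1%:R) ->
    `|u - v| <= n.+1%:R^-1.
  move=> uv; have u1 := floor_le_tmp (u * n.+1%:R); have u2 := floorD1_gt (u * n.+1%:R).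
  have v1 := floor_le_tmp (v * n.+1%:R); have v2 := floorD1_gt (v * n.+1%:R).
  move: u1 u2; rewrite uv intrD => u1 u2; move: v1 v2; rewrite intrD => v1 v2.
  rewrite -[leRHS]mul1r ler_pdivlMr// -[n.+1%:R]ger0_norm// -normrM ler_norml.
  by apply/andP; split; lra.
move: (near _ _ p1) (near _ _ p2) (near _ _ q1) (near _ _ q2) (As _ _ Ap' Aq').
set e := n.+1%:R^-1; set x' := p'.1 - _; set y' := p'.2 - _.
move=> dp1 dp2 dq1 dq2.
have sq (u u' : R) : `|u - u'| <= 2 * e -> u ^+ 2 <= u' ^+ 2 + 4 * `|u| * e.
  move=> uu; have : u * (u - u') <= `|u| * (2 * e).
    by rewrite (le_trans (ler_norm _))// normrM ler_wpM2l.
  by have := sqr_ge0 (u - u'); nra.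
have xx' : `|x - x'| <= 2 * e.
  rewrite (_ : x - x' = (p.1 - p'.1) - (q.1 - q'.1)); last by rewrite /x /x'; ring.
  by rewrite (le_trans (ler_normB _ _))// mulr2n mulrDl mul1r lerD.
have yy' : `|y - y'| <= 2 * e.
  rewrite (_ : y - y' = (p.2 - p'.2) - (q.2 - q'.2)); last by rewrite /y /y'; ring.
  by rewrite (le_trans (ler_normB _ _))// mulr2n mulrDl mul1r lerD.
move: (sq _ _ xx') (sq _ _ yy'); rewrite !exprMn => hx hy h.
have hx' := ler_wpM2l (sqr_ge0 a) hx; have hy' := ler_wpM2l (sqr_ge0 b) hy.
by apply: (le_trans (lerD hx' hy')); lra.
Qed.

Definition box (c : plane) (t : R) : set plane :=
  [set p | `|p.1 - c.1| <= t / 2 /\ `|p.2 - c.2| <= t / 2].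

Lemma boxE (c : plane) t : box c t =
  `[c.1 - t / 2, c.1 + t / 2] `*` `[c.2 - t / 2, c.2 + t / 2].
Proof.
have E (x y : R) : (`|x - y| <= t / 2) = (x \in `[y - t / 2, y + t / 2]).
  by rewrite in_itv/= ler_distl.
by apply/seteqP; split => p; rewrite /box/= !E.
Qed.

Lemma measurable_box c t : measurable (box c t).
Proof. by rewrite boxE; apply: measurableX; exact: measurable_itv. Qed.

Lemma leb2_box c t : 0 <= t -> leb2 (box c t) = (t ^+ 2)%:E.
Proof.
move=> t0; rewrite boxE product_measure1E; [|exact: measurable_itv..].
have len (x : R) : mu `[x - t / 2, x + t / 2] = t%:E.
  rewrite lebesgue_measure_itv/= lte_fin; case: ltP => h; first by rewrite -EFinD; congr EFin; lra.
  by congr EFin; lra.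
by rewrite expr2 EFinM; congr (_ * _)%E; exact: len.
Qed.

Lemma leb2_disc (r : R) : 0 < r ->
  let D := [set p : plane | p.1 ^+ 2 + p.2 ^+ 2 <= r ^+ 2] in
  measurable D /\ leb2 D = (pi * r ^+ 2)%:E.
Proof.
move=> r0 D.
have mD : measurable D.
  rewrite (_ : D = setT `&` (fun p : plane => p.1 ^+ 2 + p.2 ^+ 2 <= r ^+ 2) @^-1` [set true]).
    have : measurable_fun [set: plane] (fun p : plane => p.1 ^+ 2 + p.2 ^+ 2 <= r ^+ 2).
      apply: measurable_fun_ler => //.
      by apply: measurable_funD; apply: measurable_funX;
        [exact: measurable_fst|exact: measurable_snd].
    by move=> /(_ measurableT [set true]); exact.
  by rewrite setTI.
split => //.
have -> : leb2 D = (\int[mu]_x mu (xsection D x))%E by [].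
have -> : (\int[mu]_x mu (xsection D x) =
    \int[mu]_(x in `[(r * sin (- (pi / 2)))%R, (r * sin (pi / 2))%R])
      (2%:E * (Num.sqrt (r ^+ 2 - x ^+ 2))%:E))%E.
  rewrite sinN sin_pihalf mulrN mulr1 [RHS]integral_mkcond.
  apply: eq_integral => x _; rewrite patchE mem_setE in_itv/= -ler_norml.
  have [xr|xr] := leP `|x| r; last first.
    rewrite (_ : xsection D x = set0) ?measure0// -subset0 => y.
    rewrite xsectionP /D/= => h; move: xr; rewrite ltNge => /negP; apply.
    rewrite -(@ler_pXn2r _ 2)// ?nnegrE ?(ltW r0)// real_normK ?num_real//.
    by rewrite (le_trans _ h)// lerDl sqr_ge0.
  set w := Num.sqrt _; have w0 : 0 <= w by exact: sqrtr_ge0.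
  have -> : xsection D x = `[- w, w]%classic.
    apply/seteqP; split => y; rewrite xsectionP /D/= in_itv/= -ler_norml /w -sqrtr_sqr => h.
      by rewrite ler_wsqrtr// lerBrDl.
    move: h; rewrite ler_sqrt; first by rewrite lerBrDl.
    by rewrite subr_ge0 -[leLHS]real_normK ?num_real// ler_pXn2r ?nnegrE// ltW.
  rewrite lebesgue_measure_itv/= lte_fin; case: ltP => h.
    by rewrite -EFinM -EFinD; congr EFin; lra.
  by rewrite -EFinM; congr EFin; lra.
have p0 := pi_ge0 R.
rewrite ge0_integralZl//; last 1 first.
  apply/measurable_EFinP; apply: (measurable_funS measurableT) => //.
  apply: continuous_measurable_fun => x.
  apply: (@continuous_comp _ _ _ (fun t : R => r ^+ 2 - t ^+ 2)).
    by apply: continuousB; [exact: cst_continuous|exact: exprn_continuous].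
  exact: sqrt_continuous.
rewrite integral_semicircle//; last by lra.
rewrite cosN cos_pihalf !mulr0 -EFinM; congr EFin; by field.
Qed.

End Plane.

(** * Filling a disc by grid squares *)

Section Grid.
Context {R : realType}.
Notation leb2 := (@lebesgue_measure R \x @lebesgue_measure R)%E.
Notation plane := (R * R)%type.

Lemma ex_grid_index n (u : R) : (0 < n)%N -> 0 <= u <= 1 ->
  exists i : 'I_n, `|u - (i%:R + 1 / 2) / n%:R| <= 1 / n%:R / 2.
Proof.
move=> n0 /andP[u0]; rewrite le_eqVlt => u1.
have n0' : 0 < n%:R :> R by rewrite ltr0n.
suff [i [iu ui]] : exists i : 'I_n, (i%:R <= n%:R * u) /\ (n%:R * u <= i%:R + 1).
  exists i; rewrite (_ : u - _ = (n%:R * u - (i%:R + 1 / 2)) / n%:R); last first.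
    by field; rewrite gt_eqF.
  rewrite normrM (gtr0_norm (_ : 0 < n%:R^-1)) ?invr_gt0//.
  rewrite mulrAC ler_pM2r ?invr_gt0// ler_norml.
  by apply/andP; split; lra.
(* At [u = 1] truncation would give the index [n], so the last cell is taken. *)
case/predU1P: u1 => [->|u1].
  case: n n0 n0' => // n _ _; exists ord_max => /=; rewrite mulr1 ler_nat leqnSn.
  by rewrite -natr1.
have nu0 : 0 <= n%:R * u by rewrite mulr_ge0// ltW.
have /andP[h1 h2] := truncn_itv nu0.
have lt_n : (Num.truncn (n%:R * u) < n)%N.
  by rewrite -(ltr_nat R) (le_lt_trans h1)// gtr_pMr.
by exists (Ordinal lt_n) => /=; split => //; rewrite natr1 ltW.
Qed.

(** Centers of the [n^2] squares of side [t / n] that tile [box c t]. *)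
Definition grid n (c : plane) (t : R) (k : 'I_n * 'I_n) : plane :=
  (c.1 + t * ((k.1%:R + 1 / 2) / n%:R - 1 / 2),
   c.2 + t * ((k.2%:R + 1 / 2) / n%:R - 1 / 2)).

Lemma box_grid n (c : plane) (t : R) p : (0 < n)%N -> 0 < t -> box c t p ->
  exists k, box (@grid n c t k) (t / n%:R) p.
Proof.
move=> n0 t0 [p1 p2].
have ex (x y : R) : `|x - y| <= t / 2 -> exists i : 'I_n,
    `|x - (y + t * ((i%:R + 1 / 2) / n%:R - 1 / 2))| <= t / n%:R / 2.
  move=> xy; have [|i iu] := @ex_grid_index n ((x - y) / t + 1 / 2) n0.
    have : `|(x - y) / t| <= 1 / 2.
      by rewrite normrM (gtr0_norm (_ : 0 < t^-1)) ?invr_gt0// ler_pdivrMr// mulrC mul1r.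
    by rewrite ler_norml => /andP[]; lra.
  exists i; move: iu; rewrite -(ler_pM2l t0) -{1}(gtr0_norm t0) -normrM => h.
  apply: le_trans (le_trans h _).
    rewrite le_eqVlt; apply/orP; left; apply/eqP; congr `|_|.
    by field; rewrite ?gt_eqF ?ltr0n// ?(gt_eqF t0).
  by rewrite !mulrA mulr1.
have [i hi] := ex _ _ p1; have [j hj] := ex _ _ p2.
by exists (i, j).
Qed.

Lemma leb2_bigU (I : finType) (P : pred I) (A : I -> set plane) :
  (forall i, measurable (A i)) ->
  (leb2 (\big[setU/set0]_(i | P i) A i) <= \sum_(i | P i) leb2 (A i))%E.
Proof.
move=> mA.
suff : measurable (\big[setU/set0]_(i | P i) A i) /\
  (leb2 (\big[setU/set0]_(i | P i) A i) <= \sum_(i | P i) leb2 (A i))%E by case.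
elim/big_rec2: _ => [|i y B _ [mB IH]]; first by rewrite measure0.
split; first exact: measurableU.
apply: (le_trans (measureU2 _ _ _)) => //; [exact: mA|exact: leeD].
Qed.

(* Every cell meeting the disc of radius [1 / 2 - 2 / n] lies in the disc of
   radius [1 / 2], so the cells inside the latter cover the former. *)
Lemma grid_disc (eps : R) : 0 < eps ->
  exists n, (0 < n)%N /\ exists G : {set 'I_n * 'I_n},
    (forall k p, k \in G -> box (@grid n (0, 0) 1 k) (1 / n%:R) p ->
      p.1 ^+ 2 + p.2 ^+ 2 <= (1 / 2) ^+ 2) /\
    pi / 4 - eps <= #|G|%:R / n%:R ^+ 2.
Proof.
move=> e0; have p0 := pi_ge0 R.
(* The added 5 keeps [r = 1 / 2 - 2 / n] positive; the bound on [2 pi / eps] controls the lost area,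
   since [pi r^2 >= pi / 4 - 2 pi / n]. *)
pose n := (Num.bound (2 * pi / eps)).+4.+1; exists n; split => //.
have n0 : 0 < n%:R :> R by rewrite ltr0n.
have nV : 0 < n%:R^-1 :> R by rewrite invr_gt0.
have n5 : n%:R^-1 <= 1 / 5 :> R.
  by rewrite mul1r lef_pV2 ?posrE ?ltr0n// ler_nat.
have ne : 2 * pi / n%:R <= eps.
  rewrite ler_pdivrMr// [eps * _]mulrC -ler_pdivrMr//.
  have h : 0 <= 2 * pi / eps by rewrite divr_ge0 ?mulr_ge0// ltW.
  by rewrite (le_trans (ltW (archi_boundP h)))// ler_nat /n; do 5 apply: leqW.
pose r : R := 1 / 2 - 2 / n%:R.
have r0 : 0 < r by rewrite /r; lra.
pose cell (k : 'I_n * 'I_n) : set plane := box (grid (0, 0) 1 k) (1 / n%:R).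
pose inside (k : 'I_n * 'I_n) := `[< forall p, cell k p ->
   p.1 ^+ 2 + p.2 ^+ 2 <= (1 / 2) ^+ 2 >].
exists [set k | inside k]%SET; split.
  by move=> k p; rewrite finset.inE => /asboolP; apply.
have [mD D] := leb2_disc r0; set disc := [set p | _] in mD D.
have cov : disc `<=` \big[setU/set0]_(k | inside k) cell k.
  move=> p pr; rewrite -bigcup_pred.
  have sq_le (x y : R) : x ^+ 2 + y ^+ 2 <= r ^+ 2 -> `|x| <= r.
    move=> h; rewrite -(@ler_pXn2r _ 2)// ?nnegrE ?(ltW r0)// real_normK ?num_real//.
    by rewrite (le_trans _ h)// lerDl sqr_ge0.
  have p1 : `|p.1| <= r by exact: sq_le pr.
  have p2 : `|p.2| <= r by apply: (sq_le _ p.1); rewrite addrC.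
  have [|k pk] := @box_grid n (0, 0) 1 p isT ltr01.
    by rewrite /box/= !subr0; split; [apply: le_trans p1 _|apply: le_trans p2 _];
      rewrite /r; lra.
  exists k => //=; rewrite unfold_in; apply/asboolP => q qk.
  have dist (x y z : R) : `|x - z| <= 1 / n%:R / 2 -> `|y - z| <= 1 / n%:R / 2 ->
      `|y - x| <= n%:R^-1.
    move=> xz yz; rewrite (_ : y - x = (y - z) - (x - z)); last by ring.
    by apply: le_trans (ler_normB _ _) _; lra.
  have q1 := dist _ _ _ (proj1 pk) (proj1 qk).
  have q2 := dist _ _ _ (proj2 pk) (proj2 qk).
  have sq (x y : R) : `|x| <= r -> `|y - x| <= n%:R^-1 ->
      y ^+ 2 <= x ^+ 2 + 2 * r * n%:R^-1 + n%:R^-1 ^+ 2.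
    move=> xr yx.
    have h1 : (y - x) ^+ 2 <= n%:R^-1 ^+ 2.
      by rewrite -[leLHS]real_normK ?num_real// ler_pXn2r ?nnegrE ?(ltW nV).
    have h2 : x * (y - x) <= r * n%:R^-1.
      by rewrite (le_trans (ler_norm _))// normrM ler_pM.
    by rewrite (_ : y ^+ 2 = x ^+ 2 + 2 * (x * (y - x)) + (y - x) ^+ 2); [lra|ring].
  have s1 := sq _ _ p1 q1; have s2 := sq _ _ p2 q2.
  move: pr; rewrite /disc/= => pr.
  have : (r + 2 * n%:R^-1) ^+ 2 = (1 / 2) ^+ 2 by congr (_ ^+ 2); rewrite /r; ring.
  by have := sqr_ge0 (n%:R^-1 : R); nra.
have mbig : measurable (\big[setU/set0]_(k | inside k) cell k).
  by apply: bigsetU_measurable => k _; exact: measurable_box.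
have : (leb2 disc <= \sum_(k | inside k) leb2 (cell k))%E.
  apply: le_trans (leb2_bigU _ _); last by move=> k; exact: measurable_box.
  by apply: le_measure => //; rewrite inE.
rewrite D; under eq_bigr do rewrite leb2_box ?divr_ge0 ?ler01 ?ler0n//.
rewrite sumEFin lee_fin sumr_const => h.
rewrite cardsE; set g := #|_| in h *.
have -> : g%:R / n%:R ^+ 2 = (1 / n%:R) ^+ 2 *+ g :> R.
  by rewrite -[RHS]mulr_natl mul1r exprVn.
apply: le_trans h; rewrite /r.
have := sqr_ge0 (n%:R^-1 : R); nra.
Qed.

End Grid.

(** * Lipschitz images of planar rectangles *)

Section LipschitzImage.
Context {R : realType} {d : nat}.
Notation plane := (R * R)%type.
Variables (f : plane -> 'rV[R]_d) (T : set plane) (L : R).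
Hypothesis L0 : 0 <= L.
Hypothesis fL : forall p q, T p -> T q ->
  dotp (f p - f q) (f p - f q) <= L * ((p.1 - q.1) ^+ 2 + (p.2 - q.2) ^+ 2).

Let image_box (c : plane) (t : R) := f @` (box c t `&` T).

(** [L] is a squared Lipschitz constant, so it is itself the expected ratio of areas. The bound [C]
    is uniform in the center and in all sides up to [t0], so that it passes to the cells of a
    subdivision. *)
Let image_box_delta (delta t0 : R) (C : R) :=
  forall c t, 0 < t <= t0 -> (hausdorff2_delta delta (image_box c t) <= (C * t ^+ 2)%:E)%E.

Let enorm_image (A : set plane) (s : R) : 0 <= s ->
  (forall p q, A p -> A q -> (p.1 - q.1) ^+ 2 + (p.2 - q.2) ^+ 2 <= s ^+ 2) ->
  forall x y, (f @` (A `&` T)) x -> (f @` (A `&` T)) y -> enorm (x - y) <= Num.sqrt L * s.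
Proof.
move=> s0 As _ _ [p [Ap Tp] <-] [q [Aq Tq] <-].
rewrite enorm_le ?mulr_ge0 ?sqrtr_ge0// exprMn sqr_sqrtr//.
by rewrite (le_trans (fL Tp Tq))// ler_wpM2l// As.
Qed.

(** The whole box is a single piece of the cover. The constant is wasteful and only shows that some
    finite constant is admissible. *)
Let image_box_crude delta t0 : 0 <= t0 -> Num.sqrt L * (2 * t0) <= delta ->
  image_box_delta delta t0 (pi * L).
Proof.
move=> t00 td c t /andP[t0' tt0].
have s0 : 0 <= 2 * t by lra.
have -> : pi * L * t ^+ 2 = pi / 4 * (Num.sqrt L * (2 * t)) ^+ 2.
  by rewrite exprMn sqr_sqrtr//; field.
apply: hausdorff2_delta_le_sqr.
  rewrite mulr_ge0 ?sqrtr_ge0//= (le_trans _ td)// ler_wpM2l ?sqrtr_ge0//; lra.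
apply: enorm_image => // p q [p1 p2] [q1 q2].
have sq (x y z : R) : `|x - z| <= t / 2 -> `|y - z| <= t / 2 -> (x - y) ^+ 2 <= t ^+ 2.
  move=> xz yz; rewrite -[leLHS]real_normK ?num_real// ler_pXn2r ?nnegrE ?(ltW t0')//.
  rewrite (_ : x - y = (x - z) - (y - z)); last by ring.
  by apply: le_trans (ler_normB _ _) _; lra.
have := sq _ _ _ p1 q1; have := sq _ _ _ p2 q2; have := sqr_ge0 t; nra.
Qed.

(* A box splits into its inscribed disc, whose image is a single small set, and
   the grid cells not contained in that disc. *)
Let image_box_improve delta t0 C eps : 0 < t0 -> Num.sqrt L * (2 * t0) <= delta ->
  0 <= C -> 0 < eps -> image_box_delta delta t0 C ->
  image_box_delta delta t0 (L * (pi / 4) + C * (1 - pi / 4 + eps)).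
Proof.
move=> t00 td C0 e0 hC c t /andP[t0' tt0].
have d0 : 0 <= delta by apply: le_trans td; rewrite !mulr_ge0 ?sqrtr_ge0// ltW.
have [n [n0 [G [Gdisc Gcard]]]] := grid_disc e0.
have n0' : 0 < n%:R :> R by rewrite ltr0n.
pose disc : set plane := [set p | (p.1 - c.1) ^+ 2 + (p.2 - c.2) ^+ 2 <= (t / 2) ^+ 2].
pose cell k := image_box (@grid R n c t k) (t / n%:R).
have cov : image_box c t `<=` (f @` (disc `&` T)) `|` \bigcup_(k in [set k | k \notin G]) cell k.
  move=> _ [p [cp Tp] <-]; have [k pk] := box_grid n0 t0' cp.
  have [kG|kG] := boolP (k \in G); last by right; exists k => //; exists p.
  left; exists p => //; split => //.
  have := Gdisc k ((p.1 - c.1) / t, (p.2 - c.2) / t) kG.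
  have scale (x y z : R) : `|x - (y + t * z)| <= t / n%:R / 2 ->
      `|(x - y) / t - (0 + 1 * z)| <= 1 / n%:R / 2.
    rewrite (_ : (x - y) / t - _ = (x - (y + t * z)) / t); last by field; rewrite gt_eqF.
    rewrite normrM (gtr0_norm (_ : 0 < t^-1)) ?invr_gt0// ler_pdivrMr// => /le_trans; apply.
    by rewrite le_eqVlt; apply/orP; left; apply/eqP; field; rewrite gt_eqF.
  move=> /(_ (conj (scale _ _ _ (proj1 pk)) (scale _ _ _ (proj2 pk)))) /=.
  rewrite /disc/= !expr_div_n -mulrDl ler_pdivrMr ?exprn_gt0//.
  by move=> /le_trans; apply; rewrite le_eqVlt; apply/orP; left; apply/eqP; field.
apply: le_trans (le_hausdorff2_delta _ cov) _.
apply: le_trans (hausdorff2_deltaU _ _ _) _.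
have disc_le : (hausdorff2_delta delta (f @` (disc `&` T)) <= (L * (pi / 4) * t ^+ 2)%:E)%E.
  have -> : L * (pi / 4) * t ^+ 2 = pi / 4 * (Num.sqrt L * t) ^+ 2.
    by rewrite exprMn sqr_sqrtr//; ring.
  apply: hausdorff2_delta_le_sqr.
    rewrite mulr_ge0 ?sqrtr_ge0 ?(ltW t0')//= (le_trans _ td)// ler_wpM2l ?sqrtr_ge0//; lra.
  apply: enorm_image; first exact: ltW.
  move=> p q; rewrite /disc/= => hp hq.
  have := sqr_ge0 (p.1 - c.1 + (q.1 - c.1)); have := sqr_ge0 (p.2 - c.2 + (q.2 - c.2)).
  by rewrite !expr2 in hp hq *; nra.
have cells_le : (hausdorff2_delta delta (\bigcup_(k in [set k | k \notin G]) cell k) <=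
    (C * (1 - pi / 4 + eps) * t ^+ 2)%:E)%E.
  apply: le_trans (@hausdorff2_delta_bigU _ _ delta _ (fun k => k \notin G) cell _ d0 _) _.
    exact: subset_refl.
  have tn : 0 < t / n%:R <= t0.
    rewrite divr_gt0//= (le_trans _ tt0)// ler_pdivrMr// ler_peMr ?(ltW t0')//.
    by rewrite ler1n.
  apply: le_trans (lee_sum _ (fun k _ => hC (grid c t k) _ tn)) _.
  rewrite sumEFin lee_fin sumr_const.
  set g := #|_|; have cardG : g%:R = n%:R ^+ 2 - #|G|%:R :> R.
    have h : (#|G| + g = n * n)%N.
      by have := cardC (mem G); rewrite card_prod card_ord.
    by rewrite expr2 -natrM -h natrD addrAC subrr add0r.
  rewrite -[leLHS]mulr_natl cardG -mulrA mulrCA ler_wpM2l//.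
  rewrite expr_div_n mulrCA [leRHS]mulrC ler_wpM2l ?sqr_ge0//.
  move: Gcard; rewrite ler_pdivlMr ?exprn_gt0// ler_pdivrMr ?exprn_gt0//; lra.
by rewrite mulrDl EFinD; exact: leeD.
Qed.

(** In place of an iteration, the least admissible constant [c0] is improved once:
    [c0 <= L pi / 4 + c0 (1 - pi / 4 + e)], and [e] tending to 0 gives [c0 <= L]. *)
Let image_box_sharp delta t0 : 0 < t0 -> Num.sqrt L * (2 * t0) <= delta ->
  image_box_delta delta t0 L.
Proof.
move=> t00 td.
pose good := [set C : R | 0 <= C /\ image_box_delta delta t0 C].
have p0 := pi_gt0 R.
have g1 : good (pi * L).
  by split; [rewrite mulr_ge0// ltW|apply: image_box_crude => //; exact: ltW].
have ginf : has_inf good by split; [exists (pi * L)|exists 0 => C []].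
pose c0 := inf good.
have c00 : 0 <= c0 by apply: lb_le_inf; [exists (pi * L)|move=> C []].
have gc0 : image_box_delta delta t0 c0.
  move=> c t tt; apply/lee_addgt0Pr => e e0.
  have /andP[t0' _] := tt.
  have e0' : 0 < e / t ^+ 2 by rewrite divr_gt0// exprn_gt0.
  have [C [C0 gC] Ce] := inf_adherent e0' ginf.
  apply: le_trans (gC c t tt) _; rewrite -EFinD lee_fin.
  apply: (@le_trans _ _ ((c0 + e / t ^+ 2) * t ^+ 2)).
    by rewrite ler_pM2r ?exprn_gt0// ltW.
  by rewrite mulrDl divfK// gt_eqF// exprn_gt0.
suff c0L : c0 <= L.
  move=> c t tt; apply: le_trans (gc0 c t tt) _.
  by rewrite lee_fin ler_wpM2r// sqr_ge0.
rewrite -(@ler_pM2l _ (pi / 4)) ?divr_gt0//; apply: (@ler_invnP _ _ _ (c0)) => n.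
set e := n.+1%:R^-1; have e0 : 0 < e by rewrite invr_gt0.
have := image_box_improve t00 td c00 e0 gc0 => g2.
have : c0 <= L * (pi / 4) + c0 * (1 - pi / 4 + e).
  apply: ge_inf; first by exists 0 => C [].
  split => //; rewrite addr_ge0 ?mulr_ge0 ?divr_ge0 ?(ltW p0)//.
  by have := pihalf_lt2 R; lra.
lra.
Qed.

Lemma hausdorff2_image_box c t : 0 < t ->
  (hausdorff2 (f @` (box c t `&` T)) <= (L * t ^+ 2)%:E)%E.
Proof.
move=> t0; apply: hausdorff2_le => delta d0.
(* Boxes of side at most [t1] have images of diameter at most [delta]; the added 1 keeps the
   denominator positive when [L = 0]. *)
pose t1 := delta / (2 * (Num.sqrt L + 1)).
have sL : 0 <= Num.sqrt L by exact: sqrtr_ge0.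
have t10 : 0 < t1 by rewrite divr_gt0//; lra.
have t1d : Num.sqrt L * (2 * t1) <= delta.
  rewrite (_ : Num.sqrt L * (2 * t1) = delta * (Num.sqrt L / (Num.sqrt L + 1))); last first.
    by rewrite /t1; field; rewrite gt_eqF//; lra.
  by rewrite ger_pMr// ler_pdivrMr ?mul1r; lra.
have sharp := image_box_sharp t10 t1d.
pose n := (Num.bound (t / t1)).+1.
have n0' : 0 < n%:R :> R by rewrite ltr0n.
have tn : 0 < t / n%:R <= t1.
  rewrite divr_gt0//= ler_pdivrMr// mulrC -ler_pdivrMr//.
  have h : 0 <= t / t1 by rewrite divr_ge0// ltW.
  by rewrite (le_trans (ltW (archi_boundP h)))// ler_nat.
pose cell k := image_box (@grid R n c t k) (t / n%:R).
have cov : image_box c t `<=` \bigcup_(k in [set k | xpredT k]) cell k.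
  by move=> _ [p [cp Tp] <-]; have [k pk] := @box_grid R n c t p isT t0 cp;
    exists k => //; exists p.
apply: le_trans (@hausdorff2_delta_bigU _ _ delta _ xpredT cell _ (ltW d0) cov) _.
have cell_le k : (hausdorff2_delta delta (cell k) <= (L * (t / n%:R) ^+ 2)%:E)%E.
  exact: sharp.
apply: le_trans (lee_sum _ (fun k _ => cell_le k)) _.
rewrite sumEFin lee_fin sumr_const card_prod card_ord -[leLHS]mulr_natl natrM.
by rewrite le_eqVlt; apply/orP; left; apply/eqP; field; rewrite gt_eqF.
Qed.

(** Squares of side [t] cover the rectangle and overshoot it by at most [t] in each direction; then
    [t] tends to 0. *)
Lemma hausdorff2_image_rect (a b u v : R) : a <= b -> u <= v ->
  (hausdorff2 (f @` ([set p : plane | (a <= p.1 <= b)%R /\ (u <= p.2 <= v)%R] `&` T)) <=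
   (L * ((b - a) * (v - u)))%:E)%E.
Proof.
move=> ab uv; set A := f @` _.
suff key n : (hausdorff2 A <= (L * ((b - a + n.+1%:R^-1) * (v - u + n.+1%:R^-1)))%:E)%E.
  have fA : hausdorff2 A \is a fin_num.
    by rewrite ge0_fin_numE ?hausdorff2_ge0// (le_lt_trans (key 0%N))// ltry.
  rewrite -(fineK fA) lee_fin.
  apply: (@ler_invnP _ _ _ (L * (b - a + (v - u) + 1))) => n.
  have := key n; rewrite -(fineK fA) lee_fin => /le_trans; apply.
  rewrite -mulrA -mulrDr ler_wpM2l//.
  have : 0 < n.+1%:R^-1 :> R by rewrite invr_gt0.
  have : n.+1%:R^-1 <= 1 :> R by rewrite invf_le1// ler1n.
  set e := n.+1%:R^-1 => e1 e0.
  have : e * e <= e by rewrite ger_pMr.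
  by move=> h; rewrite [leRHS](_ : _ = (b - a + e) * (v - u + e) + (e - e * e)); [lra|ring].
set t : R := n.+1%:R^-1; have t0 : 0 < t by rewrite invr_gt0.
pose k1 := (Num.truncn ((b - a) / t)).+1; pose k2 := (Num.truncn ((v - u) / t)).+1.
have split1 (x y z : R) : x <= y -> x <= z <= y ->
    exists i : 'I_(Num.truncn ((y - x) / t)).+1, `|z - (x + t * (i%:R + 1 / 2))| <= t / 2.
  move=> xy /andP[xz zy].
  have z0 : 0 <= (z - x) / t by rewrite divr_ge0 ?subr_ge0// ltW.
  have /andP[h1 h2] := truncn_itv z0.
  have lt_k : (Num.truncn ((z - x) / t) < (Num.truncn ((y - x) / t)).+1)%N.
    by rewrite ltnS le_truncn// ler_pM2r ?invr_gt0// lerD2r.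
  exists (Ordinal lt_k) => /=; move: h1 h2.
  rewrite ler_pdivlMr// ltr_pdivrMr// -natr1 ler_norml => h1 h2.
  by apply/andP; split; lra.
pose cell (k : 'I_k1 * 'I_k2) :=
  f @` (box (a + t * (k.1%:R + 1 / 2), u + t * (k.2%:R + 1 / 2)) t `&` T).
have cov : A `<=` \bigcup_(k in [set k | xpredT k]) cell k.
  move=> _ [p [[p1 p2] Tp] <-].
  have [i hi] := split1 _ _ _ ab p1; have [j hj] := split1 _ _ _ uv p2.
  by exists (i, j) => //; exists p.
apply: le_trans (@hausdorff2_bigU _ _ _ xpredT cell _ cov) _.
apply: le_trans (lee_sum _ (fun k _ => hausdorff2_image_box _ t0)) _.
rewrite sumEFin lee_fin sumr_const card_prod !card_ord -[leLHS]mulr_natl natrM.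
have len (x y : R) : x <= y -> 0 <= (Num.truncn ((y - x) / t)).+1%:R * t <= y - x + t.
  move=> xy; rewrite mulr_ge0 ?(ltW t0)//=.
  have z0 : 0 <= (y - x) / t by rewrite divr_ge0 ?subr_ge0// ltW.
  have /andP[h1 _] := truncn_itv z0.
  by move: h1; rewrite ler_pdivlMr// -natr1; lra.
have /andP[l1 l1'] := len _ _ ab; have /andP[l2 l2'] := len _ _ uv.
rewrite mulrCA ler_wpM2l// expr2 mulrACA.
exact: ler_pM.
Qed.

End LipschitzImage.

(** * Zones of a 2-sphere *)

Section Trigonometry.
Context {R : realType}.
Implicit Types x y a b c : R.

Lemma sin_MVT x : 0 < x -> exists2 c, 0 < c < x & sin x = x * cos c.
Proof.
move=> x0.
have [|c cx] := @MVT R sin cos 0 x x0 (fun y _ => is_derive_sin y).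
  by apply: continuous_subspaceT => y; exact: continuous_sin.
rewrite sin0 !subr0 mulrC => ->; exists c => //.
Qed.

Lemma sin_sqr_le x : sin x ^+ 2 <= x ^+ 2.
Proof.
wlog x0 : x / 0 <= x => [h|].
  have [/h//|x0] := leP 0 x.
  have := h (- x); rewrite sinN !sqrrN; apply; lra.
move: x0; rewrite le_eqVlt => /predU1P[<-|/sin_MVT[c _ ->]].
  by rewrite sin0.
rewrite exprMn ler_piMr ?sqr_ge0// -[leLHS]real_normK ?num_real//.
Qed.

(** For [x > 0] the mean value theorem gives [sin x = x cos c] with [0 < c < x], and the cosine
    decreases. *)
Lemma sin_sqr_ge_cos x : `|x| <= pi / 2 -> x ^+ 2 * cos x ^+ 2 <= sin x ^+ 2.
Proof.
wlog x0 : x / 0 <= x => [h|].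
  have [/h//|x0] := leP 0 x.
  have := h (- x); rewrite sinN cosN normrN !sqrrN; apply; lra.
rewrite ger0_norm//.
move: x0; rewrite le_eqVlt => /predU1P[<-|x0 xpi]; first by rewrite expr0n/= mul0r sqr_ge0.
have [c /andP[c0 cx] ->] := sin_MVT x0.
have p0 := pi_gt0 R.
rewrite exprMn ler_wpM2l ?sqr_ge0// ler_pXn2r ?nnegrE ?cos_ge0_pihalf//; try lra.
rewrite leNgt ltr_cos ?in_itv/=; [rewrite -leNgt ltW//|lra|lra].
Qed.

(** A small sine also occurs near [pi] and [- pi]. The bound [|x| <= pi - eta] with [tau < sin eta]
    excludes this and leaves [|x| <= pi / 2], where the cosine bound applies with
    [cos^2 x >= 1 - tau^2]. *)
Lemma sin_sqr_ge x eta tau : 0 < eta <= pi / 2 -> `|x| <= pi - eta ->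
  `|sin x| <= tau -> tau < sin eta -> x ^+ 2 * (1 - tau ^+ 2) <= sin x ^+ 2.
Proof.
move=> /andP[eta0 eta1] xeta xtau taueta.
have tau0 : 0 <= tau by exact: le_trans xtau.
have [xpi|xpi] := leP `|x| (pi / 2).
  apply: le_trans (sin_sqr_ge_cos xpi); rewrite ler_wpM2l ?sqr_ge0// cos2sin2 lerD2l lerN2.
  by rewrite -[leLHS]real_normK ?num_real// ler_pXn2r ?nnegrE.
have sx : `|sin x| = sin (pi - `|x|).
  have -> : `|sin x| = `|sin `|x| |.
    by have [_|_] := ler0P x; rewrite ?sinN ?normrN.
  have nx := normr_ge0 x;
  rewrite ger0_norm; last by apply: sin_ge0_pi; apply/andP; split => //; lra.
  by rewrite sinB sinpi cospi mul0r sub0r mulN1r opprK.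
suff : sin eta <= `|sin x|
  by move=> h; have := lt_le_trans (le_lt_trans xtau taueta) h; rewrite ltxx.
rewrite sx leNgt ltr_sin ?in_itv/=; [rewrite -leNgt; lra|lra|lra].
Qed.

Lemma chord_sqr x y :
  (cos x - cos y) ^+ 2 + (sin x - sin y) ^+ 2 = 4 * sin ((x - y) / 2) ^+ 2.
Proof.
have -> : (cos x - cos y) ^+ 2 + (sin x - sin y) ^+ 2 = 2 - 2 * cos (x - y).
  by rewrite cosB; have := cos2Dsin2 x; have := cos2Dsin2 y; lra.
have {1}-> : x - y = ((x - y) / 2) *+ 2 by rewrite mulr2n; lra.
by rewrite cos_mulr2n cos2sin2; ring.
Qed.

Lemma polarE a b c : 0 <= c -> a ^+ 2 + b ^+ 2 = c ^+ 2 ->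
  exists th, [/\ - pi <= th <= pi, a = c * cos th & b = c * sin th].
Proof.
have p0 := pi_ge0 R.
rewrite le_eqVlt => /predU1P[<- /eqP|c0 abc].
  rewrite expr0n/= paddr_eq0 ?sqr_ge0// !sqrf_eq0 => /andP[/eqP -> /eqP ->].
  by exists 0; split; rewrite ?mul0r//; lra.
have ac : -1 <= a / c <= 1.
  have : `|a / c| <= 1; last by rewrite ler_norml.
  rewrite normrM (gtr0_norm (_ : 0 < c^-1)) ?invr_gt0// ler_pdivrMr// mul1r.
  rewrite -(@ler_pXn2r _ 2)// ?nnegrE ?(ltW c0)// real_normK ?num_real//.
  by rewrite -abc lerDl sqr_ge0.
have sE : c * Num.sqrt (1 - (a / c) ^+ 2) = `|b|.
  rewrite -{1}(gtr0_norm c0) -!sqrtr_sqr -sqrtrM ?sqr_ge0//; congr Num.sqrt.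
  by rewrite -[b ^+ 2](addKr (a ^+ 2)) abc; field; rewrite gt_eqF.
have [b0|b0] := leP 0 b; [exists (acos (a / c))|exists (- acos (a / c))].
  split; rewrite ?acosK ?in_itv//= ?sin_acos//.
  - by rewrite acos_lepi// andbT (le_trans _ (acos_ge0 ac)); lra.
  - by rewrite mulrC divfK// gt_eqF.
  - by rewrite sE ger0_norm.
rewrite cosN sinN; split; rewrite ?acosK ?in_itv//= ?sin_acos//.
- by rewrite lerN2 acos_lepi//= (@le_trans _ _ 0)// oppr_le0 acos_ge0.
- by rewrite mulrC divfK// gt_eqF.
- by rewrite mulrN sE ltr0_norm// opprK.
Qed.

End Trigonometry.

Definition orthonormal3 {R : realType} {d : nat} (e1 e2 e3 : 'rV[R]_d) : Prop :=
  [/\ dotp e1 e1 = 1, dotp e2 e2 = 1, dotp e3 e3 = 1 &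
    [/\ dotp e1 e2 = 0, dotp e1 e3 = 0 & dotp e2 e3 = 0]].

Section Sphere.
Context {R : realType} {d : nat}.
Variables (xi e1 e2 e3 : 'rV[R]_d).
Hypothesis orth : orthonormal3 e1 e2 e3.

Definition frame_point x y h : 'rV[R]_d := xi + (x *: e1 + y *: e2 + h *: e3).

Lemma frame_point_dist x y h x' y' h' :
  let u := frame_point x y h - frame_point x' y' h' in
  dotp u u = (x - x') ^+ 2 + (y - y') ^+ 2 + (h - h') ^+ 2.
Proof.
have -> : frame_point x y h - frame_point x' y' h' =
    (x - x') *: e1 + (y - y') *: e2 + (h - h') *: e3.
  rewrite /frame_point opprD addrACA subrr add0r !scalerBl !opprD.
  by rewrite addrACA; congr (_ + _); rewrite addrACA.
case: orth => e11 e22 e33 [e12 e13 e23] u; rewrite /u !dotpDl !dotpDr !dotpZl !dotpZr.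
rewrite (dotpC e2 e1) (dotpC e3 e1) (dotpC e3 e2) e11 e22 e33 e12 e13 e23; ring.
Qed.

Variable rho : R.
Hypothesis rho0 : 0 < rho.

Definition zone (a b : R) : set 'rV[R]_d :=
  [set z | exists x y h, [/\ x ^+ 2 + y ^+ 2 + h ^+ 2 = rho ^+ 2, a <= h <= b &
    z = frame_point x y h]].

Definition cyl_radius h := Num.sqrt (rho ^+ 2 - h ^+ 2).

Lemma cyl_radius_sqr h : - rho <= h <= rho ->
  cyl_radius h ^+ 2 = rho ^+ 2 - h ^+ 2.
Proof.
move=> hr; rewrite sqr_sqrtr// subr_ge0 -[leLHS]real_normK ?num_real//.
by rewrite ler_pXn2r ?nnegrE ?(ltW rho0)// ler_norml.
Qed.

Definition cyl_point th h := frame_point (cyl_radius h * cos th) (cyl_radius h * sin th) h.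

(** The first two terms are the squared chord of a meridian between the two heights; the last is the
    squared chord of the unit circle between the two angles, scaled by the product of the radii. *)
Lemma cyl_point_dist th h th' h' :
  let u := cyl_point th h - cyl_point th' h' in
  dotp u u = (cyl_radius h - cyl_radius h') ^+ 2 + (h - h') ^+ 2 +
    4 * (cyl_radius h * cyl_radius h') * sin ((th - th') / 2) ^+ 2.
Proof.
rewrite /= frame_point_dist.
set c := cyl_radius h; set c' := cyl_radius h'.
rewrite [4 * (c * c')]mulrC -[_ * 4 * _]mulrA -chord_sqr.
have := cos2Dsin2 th; have := cos2Dsin2 th'.
set s := sin th; set s' := sin th'; set k := cos th; set k' := cos th'.
move=> h1 h2.
have -> : (c * k - c' * k') ^+ 2 + (c * s - c' * s') ^+ 2 =
  c ^+ 2 * (k ^+ 2 + s ^+ 2) + c' ^+ 2 * (k' ^+ 2 + s' ^+ 2)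
    - 2 * c * c' * (k * k' + s * s') by ring.
have -> : (k - k') ^+ 2 + (s - s') ^+ 2 =
  (k ^+ 2 + s ^+ 2) + (k' ^+ 2 + s' ^+ 2) - 2 * (k * k' + s * s') by ring.
rewrite h1 h2; ring.
Qed.

(** With [c], [c'] the two radii, the chord [(c - c', h - h')] is orthogonal to [(c + c', h + h')],
    whose squared length is [4 rho^2 - X] by the parallelogram law; comparing components gives the
    identity. For close points it says that the chord is nearly [rho / c] times the height
    difference. *)
Lemma meridian_chord h h' : - rho <= h <= rho -> - rho <= h' <= rho ->
  let X := (cyl_radius h - cyl_radius h') ^+ 2 + (h - h') ^+ 2 in
  X * (cyl_radius h + cyl_radius h') ^+ 2 = (h - h') ^+ 2 * (4 * rho ^+ 2 - X).
Proof.
move=> hr hr' X; rewrite /X.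
have := cyl_radius_sqr hr; have := cyl_radius_sqr hr'.
set c := cyl_radius h; set c' := cyl_radius h' => E' E.
have D : (c - c') * (c + c') = (h' - h) * (h' + h).
  by rewrite -!subr_sqr E E'; ring.
have -> : ((c - c') ^+ 2 + (h - h') ^+ 2) * (c + c') ^+ 2 =
  ((c - c') * (c + c')) ^+ 2 + (h - h') ^+ 2 * (c + c') ^+ 2 by ring.
rewrite D.
have -> : 4 * rho ^+ 2 = 2 * (c ^+ 2 + h ^+ 2) + 2 * (c' ^+ 2 + h' ^+ 2) by rewrite E E'; ring.
ring.
Qed.

Lemma zone_cyl a b z : - rho <= a -> b <= rho -> zone a b z ->
  exists th h, [/\ - pi <= th <= pi, a <= h <= b & z = cyl_point th h].
Proof.
move=> ra br [x [y [h [xyh /andP[ah hb] ->]]]].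
have hr : - rho <= h <= rho by rewrite (le_trans ra)// (le_trans hb).
have := cyl_radius_sqr hr; have c0 : 0 <= cyl_radius h by exact: sqrtr_ge0.
rewrite -xyh addrK => /esym /(polarE c0) [th [thp -> ->]].
by exists th, h; split=> //; rewrite ah.
Qed.

(** The chart [f] rolls a rectangle of area [2 pi rho (b - a)] onto the strip: its first coordinate
    is arc length along the shortest parallel, of radius [c0], its second the height stretched by
    [rho / c0]. Meridian chords are not lengthened, as every radius is at least [c0]; squared
    angular chords grow by a factor at most [K], as squared radii exceed [c0^2] by at most
    [2 rho (b - a)]. *)
Lemma hausdorff2_strip a b kappa : a <= b -> 0 < kappa ->
  (forall h, a <= h <= b -> - rho <= h <= rho) ->
  (forall h, a <= h <= b -> kappa <= cyl_radius h ^+ 2) ->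
  (hausdorff2 (zone a b) <=
    ((1 + 2 * rho * (b - a) / kappa) * (2 * pi * rho * (b - a)))%:E)%E.
Proof.
move=> ab kappa0 abr cge.
(* the radius at the end point farther from the equator is the smallest *)
pose m := if `|a| <= `|b| then b else a.
have mab : a <= m <= b by rewrite /m; case: ifP; rewrite ?lexx ?ab.
have hm h : a <= h <= b -> h ^+ 2 <= m ^+ 2.
  move=> /andP[ah hb]; rewrite -[leLHS]real_normK ?num_real// -[leRHS]real_normK ?num_real//.
  have bnd (x y : R) : `|x| <= `|y| -> - `|y| <= x <= `|y| by rewrite ler_norml.
  rewrite ler_pXn2r ?nnegrE// /m ler_norml; case: (leP `|a| `|b|) => [l|/ltW l].
    by have /andP[] := bnd _ _ l; have /andP[] := bnd b b (lexx _); lra.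
  by have /andP[] := bnd _ _ l; have /andP[] := bnd a a (lexx _); lra.
set c0 := cyl_radius m.
have c0E : c0 ^+ 2 = rho ^+ 2 - m ^+ 2 by apply: cyl_radius_sqr; exact: abr.
have kc0 : kappa <= c0 ^+ 2 by exact: cge.
have c00 : 0 < c0.
  by rewrite lt0r sqrtr_ge0 andbT -sqrf_eq0 gt_eqF// (lt_le_trans kappa0).
have cmin h : a <= h <= b -> c0 <= cyl_radius h.
  by move=> hab; rewrite /c0 /cyl_radius ler_wsqrtr// lerB// hm.
have cmax h : a <= h <= b -> cyl_radius h ^+ 2 <= c0 ^+ 2 + 2 * rho * (b - a).
  move=> hab; rewrite c0E (cyl_radius_sqr (abr _ hab)).
  have /andP[h1 h2] := abr _ hab; have /andP[m1 m2] := abr _ mab.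
  move: hab mab => /andP[h3 h4] /andP[m3 m4].
  nra.
pose K : R := 1 + 2 * rho * (b - a) / kappa.
pose f (p : R * R) := cyl_point (p.1 / c0) (c0 * p.2 / rho).
pose T : set (R * R) := [set p | a <= c0 * p.2 / rho <= b].
have K0 : 0 <= K by rewrite addr_ge0// divr_ge0 ?mulr_ge0 ?subr_ge0 ?(ltW rho0) ?(ltW kappa0).
have fL p q : T p -> T q ->
    dotp (f p - f q) (f p - f q) <= K * ((p.1 - q.1) ^+ 2 + (p.2 - q.2) ^+ 2).
  rewrite /T/= => Tp Tq; rewrite /f cyl_point_dist.
  set h := c0 * p.2 / rho in Tp *; set h' := c0 * q.2 / rho in Tq *.
  set c := cyl_radius h; set c' := cyl_radius h'; set X := _ + (h - h') ^+ 2.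
  have mer : X * (c + c') ^+ 2 = (h - h') ^+ 2 * (4 * rho ^+ 2 - X).
    exact: meridian_chord (abr _ Tp) (abr _ Tq).
  have X0 : 0 <= X by rewrite addr_ge0 ?sqr_ge0.
  have XL : X <= (p.2 - q.2) ^+ 2.
    have cc : (2 * c0) ^+ 2 <= (c + c') ^+ 2.
      rewrite ler_pXn2r ?nnegrE ?mulr_ge0 ?addr_ge0 ?sqrtr_ge0//.
      by have := cmin _ Tp; have := cmin _ Tq; rewrite -/c -/c'; lra.
    have : X * (2 * c0) ^+ 2 <= (h - h') ^+ 2 * (4 * rho ^+ 2).
      rewrite (le_trans (ler_wpM2l X0 cc))// mer ler_wpM2l ?sqr_ge0//; lra.
    have -> : (h - h') ^+ 2 * (4 * rho ^+ 2) = (p.2 - q.2) ^+ 2 * (2 * c0) ^+ 2.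
      by rewrite /h /h'; field; rewrite gt_eqF.
    by rewrite ler_pM2r// exprn_gt0// mulr_gt0.
  have cc0 : 0 <= c * c' by rewrite mulr_ge0 ?sqrtr_ge0.
  have cK : c * c' <= K * c0 ^+ 2.
    have : 2 * (c * c') <= c ^+ 2 + c' ^+ 2 by have := sqr_ge0 (c - c'); lra.
    have := cmax _ Tp; have := cmax _ Tq; rewrite -/c -/c' => h1 h2 h3.
    have : c0 ^+ 2 + 2 * rho * (b - a) <= K * c0 ^+ 2; last by lra.
    rewrite (_ : K * c0 ^+ 2 = c0 ^+ 2 + 2 * rho * (b - a) * c0 ^+ 2 / kappa);
      last by rewrite /K; ring.
    rewrite lerD2l ler_pdivlMr// ler_wpM2l//.
    by rewrite mulr_ge0 ?subr_ge0// mulr_ge0// ltW.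
  have sL : 4 * (c * c') * sin ((p.1 / c0 - q.1 / c0) / 2) ^+ 2 <= K * (p.1 - q.1) ^+ 2.
    apply: (@le_trans _ _ (4 * (c * c') * ((p.1 / c0 - q.1 / c0) / 2) ^+ 2)).
      by apply: ler_wpM2l; [rewrite mulr_ge0|exact: sin_sqr_le].
    rewrite (_ : 4 * _ * _ = c * c' * ((p.1 - q.1) ^+ 2 / c0 ^+ 2)); last first.
      by field; rewrite gt_eqF.
    apply: (@le_trans _ _ (K * c0 ^+ 2 * ((p.1 - q.1) ^+ 2 / c0 ^+ 2))).
      by rewrite ler_wpM2r// divr_ge0 ?sqr_ge0.
    by rewrite le_eqVlt; apply/orP; left; apply/eqP; field; rewrite gt_eqF.
  rewrite mulrDr addrC lerD// (le_trans XL)// ler_peMl ?sqr_ge0//.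
  by rewrite /K lerDl divr_ge0 ?mulr_ge0 ?subr_ge0 ?(ltW rho0) ?(ltW kappa0).
have p0 := pi_ge0 R.
have := @hausdorff2_image_rect R d f T K K0 fL (- (pi * c0)) (pi * c0)
  (rho * a / c0) (rho * b / c0).
set A := f @` _ => hA.
have cov : zone a b `<=` A.
  move=> z zz; have /andP[ra _] : - rho <= a <= rho by apply: abr; rewrite lexx.
  have /andP[_ br] : - rho <= b <= rho by apply: abr; rewrite ab lexx.
  have [th [h [/andP[th1 th2] hab ->]]] := zone_cyl ra br zz.
  have hE : c0 * (rho * h / c0) / rho = h by field; rewrite !gt_eqF.
  exists (c0 * th, rho * h / c0); last by rewrite /f/= hE mulrAC divff ?mul1r// gt_eqF.
  split; last by rewrite /T/= hE.
  move: hab => /andP[ah hb] /=; split.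
    by apply/andP; split; nra.
  by rewrite !ler_pM2r ?invr_gt0// !ler_pM2l// ah.
apply: le_trans (le_hausdorff2 cov) _; apply: le_trans (hA _ _) _.
- by have := mulr_ge0 p0 (ltW c00); lra.
- by rewrite ler_pM2r ?invr_gt0// ler_pM2l.
rewrite lee_fin -/K le_eqVlt; apply/orP; left; apply/eqP; congr (_ * _).
by field; rewrite gt_eqF.
Qed.

End Sphere.

(** * Upper bounds for the area of a zone *)

Section Zone.
Context {R : realType} {d : nat}.
Variables (xi e1 e2 e3 : 'rV[R]_d).
Hypothesis orth : orthonormal3 e1 e2 e3.
Variable rho : R.
Hypothesis rho0 : 0 < rho.

Local Notation zone := (zone xi e1 e2 e3 rho).
Local Notation frame_point := (frame_point xi e1 e2 e3).
Local Notation cyl_point := (cyl_point xi e1 e2 e3 rho).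
Local Notation cyl_radius := (cyl_radius rho).
Local Notation leb2 := (@lebesgue_measure R \x @lebesgue_measure R)%E.

Lemma cyl_radius_sqr_ge a b : - rho < a -> b < rho ->
  exists2 kappa, 0 < kappa & forall h, a <= h <= b ->
    - rho <= h <= rho /\ kappa ^+ 2 <= cyl_radius h ^+ 2.
Proof.
move=> ra br; pose m := Num.max 0 (Num.max (- a) b).
have m0 : 0 <= m by rewrite le_max lexx.
have mr : m < rho by rewrite !gt_max rho0/= br andbT ltrNl.
have k0 : 0 < rho ^+ 2 - m ^+ 2 by rewrite subr_gt0 ltr_pXn2r// nnegrE ltW.
exists (Num.sqrt (rho ^+ 2 - m ^+ 2)); first by rewrite sqrtr_gt0.
move=> h /andP[ah hb].
have hr : - rho <= h <= rho by rewrite (le_trans _ ah)/= ?(le_trans hb)// ltW.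
split => //; rewrite (cyl_radius_sqr rho0 hr) sqr_sqrtr ?(ltW k0)// lerD2l lerN2.
rewrite -[leLHS]real_normK ?num_real// ler_pXn2r ?nnegrE// ler_norml.
have m1 : - a <= m by rewrite !le_max lexx orbT.
have m2 : b <= m by rewrite !le_max lexx !orbT.
by apply/andP; split; lra.
Qed.

(** In [n + 1] strips of equal height the relative error of each bound is of order [1 / (n + 1)],
    and so is that of their sum. *)
Lemma hausdorff2_zone_le a b : - rho < a -> a <= b -> b < rho ->
  (hausdorff2 (zone a b) <= (2 * pi * rho * (b - a))%:E)%E.
Proof.
move=> ra ab br; have [kap kap0 kapP] := cyl_radius_sqr_ge ra br.
pose C := 2 * rho * (b - a) / kap ^+ 2 * (2 * pi * rho * (b - a)).
have k20 : 0 < kap ^+ 2 by rewrite exprn_gt0.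
suff key n : (hausdorff2 (zone a b) <= (2 * pi * rho * (b - a) + C / n.+1%:R)%:E)%E.
  have fA : hausdorff2 (zone a b) \is a fin_num.
    by rewrite ge0_fin_numE ?hausdorff2_ge0// (le_lt_trans (key 0%N))// ltry.
  rewrite -(fineK fA) lee_fin; apply: (@ler_invnP _ _ _ C) => n.
  by have := key n; rewrite -(fineK fA) lee_fin.
set N : R := n.+1%:R; have N0 : 0 < N by rewrite ltr0n.
pose w := (b - a) / N; have w0 : 0 <= w by rewrite divr_ge0 ?subr_ge0// ltW.
have wN : N * w = b - a by rewrite mulrC divfK// gt_eqF.
pose strip (i : 'I_n.+1) := zone (a + i%:R * w) (a + (i%:R + 1) * w).
have cov : zone a b `<=` \bigcup_(i in [set i | xpredT i]) strip i.
  move=> z [x [y [h [xyh /andP[ah hb] ->]]]].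
  have [|i hi] := @ex_grid_index R n.+1 ((h - a) / (b - a)) isT.
    have [->|ba] := eqVneq a b; first by rewrite subrr invr0 mulr0 lexx ler01.
    have ba0 : 0 < b - a by rewrite subr_gt0 lt_neqAle ba.
    by rewrite divr_ge0 ?subr_ge0//= ler_pdivrMr// mul1r lerD2r.
  exists i => //; exists x, y, h; split => //.
  have : `|(h - a) - (i%:R + 1 / 2) * w| <= 1 / 2 * w.
    move: hi; rewrite -/N; have [ba|ba] := eqVneq (b - a) 0.
      move=> _; rewrite /w ba mul0r !mulr0 subr0 normr_le0 subr_eq0.
      by rewrite eq_le ah andbT; lra.
    have ba0 : 0 < b - a by rewrite lt0r ba subr_ge0.
    rewrite -(ler_pM2l ba0) -{1}(gtr0_norm ba0) -normrM => hh.
    apply: le_trans (le_trans hh _).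
      rewrite le_eqVlt; apply/orP; left; apply/eqP; congr `|_|.
      by rewrite /w; field; rewrite ba gt_eqF.
    by rewrite /w le_eqVlt; apply/orP; left; apply/eqP; field; rewrite gt_eqF.
  by rewrite ler_norml => /andP[]; lra.
have strip_le i : (hausdorff2 (strip i) <=
    ((1 + 2 * rho * w / kap ^+ 2) * (2 * pi * rho * w))%:E)%E.
  have iN : i%:R + 1 <= N by rewrite natr1 ler_nat.
  have i0 : 0 <= i%:R :> R by [].
  have sub h : a + i%:R * w <= h <= a + (i%:R + 1) * w -> a <= h <= b.
    have h1 : 0 <= i%:R * w by rewrite mulr_ge0.
    have h2 : (i%:R + 1) * w <= N * w by rewrite ler_wpM2r.
    by move=> /andP[]; rewrite wN in h2; lra.
  have wE : w = a + (i%:R + 1) * w - (a + i%:R * w) by ring.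
  rewrite [X in (1 + 2 * rho * X / _) * (_ * X)]wE.
  apply: hausdorff2_strip => //; first by lra.
  - by move=> h /sub /kapP[].
  - by move=> h /sub /kapP[].
apply: le_trans (@hausdorff2_bigU _ _ _ xpredT strip _ cov) _.
apply: le_trans (lee_sum _ (fun i _ => strip_le i)) _.
rewrite sumEFin lee_fin sumr_const card_ord -[leLHS]mulr_natl -/N.
rewrite le_eqVlt; apply/orP; left; apply/eqP.
by rewrite /C /w; field; rewrite !gt_eqF.
Qed.

(* Near a pole the cylinder chart degenerates; the graph of the height over the
   equatorial plane gives a crude bound, which suffices there. *)
Lemma hausdorff2_cap_le (s eta : R) (A : set 'rV[R]_d) : s ^+ 2 = 1 ->
  0 < eta <= rho / 4 ->
  (forall z, A z -> exists x y h, [/\ x ^+ 2 + y ^+ 2 + h ^+ 2 = rho ^+ 2,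
     rho - eta <= s * h & z = frame_point x y h]) ->
  (hausdorff2 A <= (16 * rho * eta)%:E)%E.
Proof.
move=> s1 /andP[eta0 etar] AP.
(* The sign [s] selects the pole. On [T] the graph has slope at most 1, hence the squared Lipschitz
   constant 2. *)
pose f (p : R * R) := frame_point p.1 p.2 (s * Num.sqrt (rho ^+ 2 - (p.1 ^+ 2 + p.2 ^+ 2))).
pose T : set (R * R) := [set p | p.1 ^+ 2 + p.2 ^+ 2 <= rho ^+ 2 / 2].
have fL p q : T p -> T q ->
    dotp (f p - f q) (f p - f q) <= 2 * ((p.1 - q.1) ^+ 2 + (p.2 - q.2) ^+ 2).
  rewrite /T/= => Tp Tq; rewrite /f frame_point_dist// -mulrBr exprMn s1 mul1r.
  set P := p.1 ^+ 2 + _ in Tp *; set Q := q.1 ^+ 2 + _ in Tq *.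
  set D := (p.1 - q.1) ^+ 2 + _.
  have D0 : 0 <= D by rewrite addr_ge0 ?sqr_ge0.
  have r20 : 0 < rho ^+ 2 by rewrite exprn_gt0.
  set h := Num.sqrt (rho ^+ 2 - P); set h' := Num.sqrt (rho ^+ 2 - Q).
  have hE : h ^+ 2 = rho ^+ 2 - P by rewrite sqr_sqrtr//; lra.
  have hE' : h' ^+ 2 = rho ^+ 2 - Q by rewrite sqr_sqrtr//; lra.
  pose k := Num.sqrt (rho ^+ 2 / 2).
  have kE : k ^+ 2 = rho ^+ 2 / 2 by rewrite sqr_sqrtr//; lra.
  have k0 : 0 <= k by exact: sqrtr_ge0.
  have kh : k <= h by rewrite ler_wsqrtr//; lra.
  have kh' : k <= h' by rewrite ler_wsqrtr//; lra.
  have hh : 2 * rho ^+ 2 <= (h + h') ^+ 2.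
    have -> : 2 * rho ^+ 2 = (2 * k) ^+ 2 by rewrite exprMn kE; field.
    by rewrite ler_pXn2r ?nnegrE//; lra.
  have hD : (h - h') ^+ 2 * (h + h') ^+ 2 <= D * (2 * rho ^+ 2).
    have -> : (h - h') ^+ 2 * (h + h') ^+ 2 = (h ^+ 2 - h' ^+ 2) ^+ 2 by ring.
    rewrite hE hE'.
    have -> : (rho ^+ 2 - P - (rho ^+ 2 - Q)) ^+ 2 =
      ((p.1 - q.1) * (p.1 + q.1) + (p.2 - q.2) * (p.2 + q.2)) ^+ 2 by rewrite /P /Q; ring.
    apply: (@le_trans _ _ (D * ((p.1 + q.1) ^+ 2 + (p.2 + q.2) ^+ 2))).
      rewrite -subr_ge0 (_ : _ - _ =
        ((p.1 - q.1) * (p.2 + q.2) - (p.2 - q.2) * (p.1 + q.1)) ^+ 2) ?sqr_ge0//.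
      by rewrite /D; ring.
    rewrite ler_wpM2l//; have := sqr_ge0 (p.1 - q.1); have := sqr_ge0 (p.2 - q.2).
    rewrite /P /Q in Tp Tq; nra.
  have : (h - h') ^+ 2 <= D.
    rewrite -(@ler_pM2r _ (2 * rho ^+ 2)) ?mulr_gt0//.
    by apply: le_trans hD; rewrite ler_wpM2l ?sqr_ge0.
  by lra.
(* The cap projects into the disc of squared radius [2 rho eta], at most [rho^2 / 2] since
   [eta <= rho / 4]; [t] is the side of the square around that disc. *)
pose t := 2 * Num.sqrt (2 * rho * eta).
have tpos : 0 < 2 * rho * eta by rewrite !mulr_gt0.
have t0 : 0 < t by rewrite mulr_gt0// sqrtr_gt0.
have -> : 16 * rho * eta = 2 * t ^+ 2.
  by rewrite exprMn sqr_sqrtr ?(ltW tpos)//; ring.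
apply: le_trans (hausdorff2_image_box _ fL (0, 0) t0); last by [].
apply: le_hausdorff2 => z /AP [x [y [h [xyh he ->]]]].
have hn : s * h <= rho.
  rewrite (le_trans (ler_norm _))// -(@ler_pXn2r _ 2)// ?nnegrE ?(ltW rho0)//.
  rewrite real_normK ?num_real// exprMn s1 mul1r -xyh lerDr.
  by rewrite addr_ge0 ?sqr_ge0.
have sh0 : 0 <= s * h by lra.
have xy : x ^+ 2 + y ^+ 2 <= 2 * rho * eta.
  have : x ^+ 2 + y ^+ 2 = (rho - s * h) * (rho + s * h).
    by rewrite -subr_sqr exprMn s1 mul1r -xyh addrK.
  move=> ->; rewrite mulrC -mulrA mulrCA mulrA; nra.
have hE : s * Num.sqrt (rho ^+ 2 - (x ^+ 2 + y ^+ 2)) = h.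
  have -> : rho ^+ 2 - (x ^+ 2 + y ^+ 2) = (s * h) ^+ 2.
    by rewrite -xyh exprMn s1; ring.
  by rewrite sqrtr_sqr ger0_norm// mulrA -expr2 s1 mul1r.
exists (x, y); last by rewrite /f/= hE.
split; last by rewrite /T/=; nra.
have sq (u v : R) : u ^+ 2 + v ^+ 2 <= 2 * rho * eta -> `|u - 0| <= t / 2.
  move=> uv; rewrite subr0 /t mulrAC divff ?mul1r// -sqrtr_sqr ler_wsqrtr//.
  by rewrite (le_trans _ uv)// lerDl sqr_ge0.
by split; [exact: sq xy|apply: (sq _ x); rewrite addrC].
Qed.

Lemma hausdorff2_zone_top_le a : - rho <= a <= rho ->
  (hausdorff2 (zone a rho) <= (2 * pi * rho * (rho - a))%:E)%E.
Proof.
move=> /andP[ra ar]; have p0 := pi_ge0 R.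
suff key n : (hausdorff2 (zone a rho) <=
    (2 * pi * rho * (rho - a) + 8 * rho ^+ 2 / n.+1%:R)%:E)%E.
  have fA : hausdorff2 (zone a rho) \is a fin_num.
    by rewrite ge0_fin_numE ?hausdorff2_ge0// (le_lt_trans (key 0%N))// ltry.
  rewrite -(fineK fA) lee_fin; apply: (@ler_invnP _ _ _ (8 * rho ^+ 2)) => n.
  by have := key n; rewrite -(fineK fA) lee_fin.
(* The two polar caps cost at most [32 rho eta], which this choice turns into the allowed
   [8 rho^2 / (n + 1)]. The southern cap is set apart in all cases, as [a] may be [- rho]. *)
pose eta := rho / 4 / n.+1%:R.
have eta0 : 0 < eta by rewrite !divr_gt0.
have eta1 : eta <= rho / 4 by rewrite ler_pdivrMr// ler_peMr ?ler1n// divr_ge0// ltW.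
have etaP : 0 < eta <= rho / 4 by rewrite eta0.
pose a' := Num.max a (- rho + eta); pose b' := rho - eta.
have cov : zone a rho `<=` zone (- rho) (- rho + eta) `|` zone (rho - eta) rho `|` zone a' b'.
  move=> z [x [y [h [xyh /andP[ah hr] ->]]]].
  have [h1|h1] := leP h (- rho + eta).
    by left; left; exists x, y, h; split => //; rewrite (le_trans ra ah).
  have [h2|h2] := leP (rho - eta) h.
    by left; right; exists x, y, h; split => //; rewrite h2.
  by right; exists x, y, h; split => //; rewrite ge_max ah (ltW h1) ltW.
apply: le_trans (le_hausdorff2 cov) _.
apply: le_trans (hausdorff2U _ _) _.
have south : (hausdorff2 (zone (- rho) (- rho + eta)) <= (16 * rho * eta)%:E)%E.
  apply: (@hausdorff2_cap_le (-1)) => //; first by rewrite sqrrN expr1n.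
  move=> z [x [y [h [xyh /andP[h1 h2] ->]]]]; exists x, y, h; split => //; lra.
have north : (hausdorff2 (zone (rho - eta) rho) <= (16 * rho * eta)%:E)%E.
  apply: (@hausdorff2_cap_le 1) => //; first by rewrite expr1n.
  move=> z [x [y [h [xyh /andP[h1 h2] ->]]]]; exists x, y, h; split => //; lra.
have middle : (hausdorff2 (zone a' b') <= (2 * pi * rho * (rho - a))%:E)%E.
  have aa' : a <= a' by rewrite le_max lexx.
  have [ab'|ba'] := leP a' b'.
    apply: le_trans (hausdorff2_zone_le _ ab' _) _.
    - by rewrite lt_max ltrDl eta0 orbT.
    - by rewrite /b' ltrBlDr ltrDl.
    by rewrite lee_fin ler_wpM2l ?mulr_ge0 ?(ltW rho0)// /b'; lra.
  rewrite (_ : zone a' b' = set0).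
    rewrite (le_trans (hausdorff2_le (b := 0%E) _))//.
      by move=> delta d0; rewrite hausdorff2_delta0// ltW.
    by rewrite lee_fin !mulr_ge0 ?subr_ge0 ?(ltW rho0).
  by rewrite -subset0 => z [x [y [h [_ /andP[h1 h2] _]]]]; move: ba'; rewrite ltNge (le_trans h1).
apply: le_trans (leeD (le_trans (hausdorff2U _ _) (leeD south north)) middle) _.
rewrite -!EFinD lee_fin /eta le_eqVlt; apply/orP; left; apply/eqP.
by field.
Qed.

End Zone.

(** * Lower bound and exact area of a polar zone *)

Section ZoneLower.
Context {R : realType} {d : nat}.
Variables (xi e1 e2 e3 : 'rV[R]_d).
Hypothesis orth : orthonormal3 e1 e2 e3.
Variable rho : R.
Hypothesis rho0 : 0 < rho.

Local Notation zone := (zone xi e1 e2 e3 rho).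
Local Notation cyl_point := (cyl_point xi e1 e2 e3 rho).
Local Notation cyl_radius := (cyl_radius rho).
Local Notation leb2 := (@lebesgue_measure R \x @lebesgue_measure R)%E.

(* Cylinder coordinates preserve area; around a parallel of radius [c] they are
   nearly isometric once the angle is scaled by [c] and the height by
   [rho / c]. *)
Lemma cyl_chart_expansion (eta kap s th h th' h' : R) :
  0 < eta <= pi / 2 -> 0 < kap -> 0 <= s <= kap -> s / (2 * kap) < sin eta ->
  - rho <= h <= rho -> - rho <= h' <= rho ->
  kap <= cyl_radius h -> kap <= cyl_radius h' ->
  `|(th - th') / 2| <= pi - eta ->
  enorm (cyl_point th h - cyl_point th' h') <= s ->
  forall c, kap <= c -> `|c - cyl_radius h| <= s -> `|c - cyl_radius h'| <= s ->
  (c * (th - th')) ^+ 2 + (rho / c * (h - h')) ^+ 2 <= (1 + 5 * (s / kap)) * s ^+ 2.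
Proof.
move=> etap kap0 /andP[s0 sk] seta hr hr' kh kh' thth us c kc ch ch'.
move: us; rewrite enorm_le// cyl_point_dist//.
have mer := meridian_chord rho0 hr hr'.
have cr := cyl_radius_sqr rho0 hr.
move: mer; cbv zeta.
set g := cyl_radius h in kh ch cr *; set g' := cyl_radius h' in kh' ch' *.
set X := (g - g') ^+ 2 + (h - h') ^+ 2; set S := sin _.
move=> mer us.
have c0 : 0 < c by apply: lt_le_trans kc.
have g0 : 0 < g by apply: lt_le_trans kh.
have g0' : 0 < g' by apply: lt_le_trans kh'.
have X0 : 0 <= X by rewrite addr_ge0 ?sqr_ge0.
have S0 : 0 <= S ^+ 2 by rewrite sqr_ge0.
have gg0 : 0 <= g * g' by rewrite mulr_ge0 ?ltW.
have Xs : X <= s ^+ 2 by have := mulr_ge0 gg0 S0; lra.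
set y := s / kap.
have y0 : 0 <= y by rewrite divr_ge0// ltW.
have y1 : y <= 1 by rewrite ler_pdivrMr// mul1r.
have sE : s = y * kap by rewrite divfK// gt_eqF.
(* The factor [(1 + y)^2] pays for replacing the radii by [c], and [1 - y^2 / 4] for replacing arcs
   by chords; 5 is large enough for all [0 <= y <= 1]. *)
have K1 : (1 + y) ^+ 2 <= (1 + 5 * y) * (1 - y ^+ 2 / 4).
  have y2 : y * y <= y by rewrite ler_piMr.
  have y3 : y * (y * y) <= y * y by rewrite ler_wpM2l.
  lra.
have D0 : 0 < 1 - y ^+ 2 / 4.
  have : y ^+ 2 <= 1 by rewrite expr_le1.
  lra.
have gc : g <= (1 + y) * c.
  by move: ch; rewrite ler_norml => /andP[]; rewrite sE; have := ler_wpM2l y0 kc; lra.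
have gc' : g' <= (1 + y) * c.
  by move: ch'; rewrite ler_norml => /andP[]; rewrite sE; have := ler_wpM2l y0 kc; lra.
have cg : c <= (1 + y) * g.
  by move: ch; rewrite ler_norml => /andP[]; rewrite sE; have := ler_wpM2l y0 kh; lra.
have cg' : c <= (1 + y) * g'.
  by move: ch'; rewrite ler_norml => /andP[]; rewrite sE; have := ler_wpM2l y0 kh'; lra.
have rk : kap ^+ 2 <= rho ^+ 2.
  apply: (@le_trans _ _ (g ^+ 2)); first by rewrite ler_pXn2r// nnegrE ltW.
  by rewrite cr lerBlDr lerDl sqr_ge0.
have H : (rho / c * (h - h')) ^+ 2 <= (1 + 5 * y) * X.
  have r4 : 4 * rho ^+ 2 * (1 - y ^+ 2 / 4) <= 4 * rho ^+ 2 - X.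
    have : s ^+ 2 <= y ^+ 2 * rho ^+ 2 by rewrite sE exprMn ler_wpM2l ?sqr_ge0.
    by lra.
  have Q : (h - h') ^+ 2 * (4 * rho ^+ 2 * (1 - y ^+ 2 / 4)) <= X * (2 * ((1 + y) * c)) ^+ 2.
    apply: (@le_trans _ _ (X * (g + g') ^+ 2)).
      by rewrite mer ler_wpM2l ?sqr_ge0.
    rewrite ler_wpM2l// ler_pXn2r ?nnegrE//; [|by lra|by lra..].
    by have := mulr_ge0 y0 (ltW c0); lra.
  have {}Q : (rho / c * (h - h')) ^+ 2 * (1 - y ^+ 2 / 4) <= X * (1 + y) ^+ 2.
    rewrite -(@ler_pM2r _ (4 * c ^+ 2)) ?mulr_gt0 ?exprn_gt0//.
    rewrite (_ : _ * (4 * c ^+ 2) = (h - h') ^+ 2 * (4 * rho ^+ 2 * (1 - y ^+ 2 / 4))); last first.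
      by field; rewrite gt_eqF.
    by apply: le_trans Q _; rewrite le_eqVlt; apply/orP; left; apply/eqP; ring.
  rewrite -(@ler_pM2r _ (1 - y ^+ 2 / 4))// (le_trans Q)//.
  by rewrite [_ * X]mulrC -mulrA ler_wpM2l.
(* A small chord forces a small sine, and the excluded seam turns this into a small angle. *)
have TH : (c * (th - th')) ^+ 2 <= (1 + 5 * y) * (4 * (g * g') * S ^+ 2).
  have gk : kap ^+ 2 <= g * g' by rewrite expr2 ler_pM// ltW.
  have Sy : `|S| <= y / 2.
    have y20 : 0 <= y / 2 by lra.
    rewrite -(@ler_pXn2r _ 2)// ?nnegrE// real_normK ?num_real//.
    rewrite -(@ler_pM2l _ (4 * kap ^+ 2)) ?mulr_gt0 ?exprn_gt0//.
    rewrite (_ : _ * (y / 2) ^+ 2 = s ^+ 2); last by rewrite sE; field.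
    have : 4 * kap ^+ 2 * S ^+ 2 <= 4 * (g * g') * S ^+ 2 by rewrite ler_wpM2r// ler_wpM2l.
    by lra.
  have yeta : y / 2 < sin eta by rewrite /y -mulrA -invfM [kap * 2]mulrC.
  have := sin_sqr_ge etap thth Sy yeta; rewrite -/S => Q.
  have E : (th - th') ^+ 2 * (1 - y ^+ 2 / 4) <= 4 * S ^+ 2.
    rewrite (_ : _ * _ = 4 * (((th - th') / 2) ^+ 2 * (1 - (y / 2) ^+ 2))); last by field.
    by rewrite ler_wpM2l.
  have cc : c ^+ 2 <= (1 + y) ^+ 2 * (g * g').
    rewrite (_ : (1 + y) ^+ 2 * (g * g') = ((1 + y) * g) * ((1 + y) * g')); last by ring.
    by rewrite expr2 ler_pM// ltW.
  rewrite -(@ler_pM2r _ (1 - y ^+ 2 / 4))// exprMn -[leLHS]mulrA.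
  apply: (@le_trans _ _ ((1 + y) ^+ 2 * (g * g') * (4 * S ^+ 2))).
    apply: ler_pM => //; first exact: exprn_ge0 (ltW c0).
    by apply: mulr_ge0; [exact: sqr_ge0|exact: ltW].
  rewrite [leLHS](_ : _ = (1 + y) ^+ 2 * (4 * (g * g') * S ^+ 2)); last by ring.
  rewrite [leRHS](_ : _ = (1 + 5 * y) * (1 - y ^+ 2 / 4) * (4 * (g * g') * S ^+ 2)); last by ring.
  by apply: ler_wpM2r => //; apply: mulr_ge0 => //; exact: mulr_ge0.
have : (1 + 5 * y) * (X + 4 * (g * g') * S ^+ 2) <= (1 + 5 * y) * s ^+ 2.
  by rewrite ler_wpM2l//; lra.
by rewrite mulrDr; lra.
Qed.

(** On a piece of small diameter the radius is nearly constant, so a single [c] can scale the chart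
    on the whole piece. *)
Lemma cyl_radius_dist th h th' h' (s : R) : 0 <= s ->
  enorm (cyl_point th h - cyl_point th' h') <= s -> `|cyl_radius h - cyl_radius h'| <= s.
Proof.
move=> s0; rewrite enorm_le// cyl_point_dist// => us.
rewrite -(@ler_pXn2r _ 2)// ?nnegrE// real_normK ?num_real//.
have : 0 <= 4 * (cyl_radius h * cyl_radius h') * sin ((th - th') / 2) ^+ 2.
  apply: mulr_ge0; last exact: sqr_ge0.
  by apply: mulr_ge0 => //; apply: mulr_ge0; exact: sqrtr_ge0.
by have := sqr_ge0 (h - h'); lra.
Qed.

(** Each set of a cover is pulled back to the rectangle of angles in [[eta, 2 pi - eta]] and heights
    in [[a, b]]. Scaling by [c] and [rho / c] makes the diameter of the pull-back at most [sqrt K]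
    times that of the set. The product of the scales is [rho], so the measurable hull has area at
    most [K / rho] times the weight of the set, and countable subadditivity in the plane
    concludes. *)
Lemma hausdorff2_delta_zone_ge a b eta kap delta :
  a <= b -> 0 < eta <= pi / 2 -> 0 < kap ->
  (forall h, a <= h <= b -> - rho <= h <= rho /\ kap <= cyl_radius h) ->
  0 < delta <= kap -> delta / (2 * kap) < sin eta ->
  (((2 * pi - 2 * eta) * (b - a) * rho)%:E <=
   (1 + 5 * (delta / kap))%:E * hausdorff2_delta delta (zone a b))%E.
Proof.
move=> ab /andP[eta0 eta1] kap0 kapP /andP[d0 dk] deta; have p0 := pi_gt0 R.
set K := 1 + 5 * (delta / kap).
have K0 : 0 < K by rewrite ltr_wpDr// mulr_ge0// divr_ge0 ?(ltW d0)// ltW.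
rewrite -lee_pdivrMl//; apply: le_ereal_inf_tmp => _ [F [AF Fd] <-].
rewrite -/(cover_weight F) lee_pdivrMl//.
pose rect : set (R * R) := `[eta, 2 * pi - eta]%classic `*` `[a, b]%classic.
have mrect : measurable rect by apply: measurableX; exact: measurable_itv.
have rectE : leb2 rect = ((2 * pi - 2 * eta) * (b - a))%:E.
  rewrite product_measure1E; [|exact: measurable_itv..].
  have len (x y : R) : x <= y -> lebesgue_measure `[x, y] = (y - x)%:E.
    by rewrite lebesgue_measure_itv/= lte_fin; case: ltgtP => [//|//|->]; rewrite subrr.
  rewrite EFinM; congr (_ * _)%E; last exact: len.
  by rewrite [2 * eta]mulr_natl mulr2n opprD addrA; apply: len; lra.
have hull i : exists B : set (R * R), [/\ measurable B,
    [set p | rect p /\ F i (cyl_point p.1 p.2)] `<=` B &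
    (leb2 B <= (K / rho)%:E * cover_weight F i)%E].
  have fd : diam (F i) \is a fin_num.
    by rewrite ge0_fin_numE ?diam_ge0// (le_lt_trans (Fd i))// ltry.
  set s := fine (diam (F i)).
  have sE : diam (F i) = s%:E by rewrite fineK.
  have s0 : 0 <= s by rewrite fine_ge0// diam_ge0.
  have sd : s <= delta by have := Fd i; rewrite sE lee_fin.
  set A := [set p | _].
  have [[p0' Ap0]|nA] := pselect (A !=set0); last first.
    exists set0; split => //; first by move=> p Ap; apply: nA; exists p.
    by rewrite measure0 mule_ge0 ?cover_weight_ge0// lee_fin divr_ge0// ltW.
  have dist p q : A p -> A q ->
      enorm (cyl_point p.1 p.2 - cyl_point q.1 q.2) <= s.
    move=> [_ Fp] [_ Fq].
    by have := le_diam Fp Fq; rewrite sE lee_fin.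
  have Ah p : A p -> - rho <= p.2 <= rho /\ kap <= cyl_radius p.2.
    by move=> [[_ /=]]; rewrite in_itv/= => /kapP.
  set c := cyl_radius p0'.2.
  have [_ kc] := Ah _ Ap0; rewrite -/c in kc.
  have c0 : 0 < c by apply: lt_le_trans kc.
  have sk : s / kap <= delta / kap by rewrite ler_pM2r ?invr_gt0.
  have rc0 : 0 < rho / c by rewrite divr_gt0.
  have Ks0 : 0 <= Num.sqrt K * s by rewrite mulr_ge0 ?sqrtr_ge0.
  have As p q : A p -> A q ->
      (c * (p.1 - q.1)) ^+ 2 + (rho / c * (p.2 - q.2)) ^+ 2 <= (Num.sqrt K * s) ^+ 2.
    move=> Ap Aq.
    rewrite [leRHS](_ : _ = K * s ^+ 2); last by rewrite exprMn sqr_sqrtr ?(ltW K0).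
    have [hp kp] := Ah _ Ap; have [hq kq] := Ah _ Aq.
    apply: (@le_trans _ _ ((1 + 5 * (s / kap)) * s ^+ 2)).
      apply: (@cyl_chart_expansion eta) => //.
      - by rewrite eta0.
      - by rewrite s0 (le_trans sd).
      - by rewrite (le_lt_trans _ deta)// ler_pM2r// invr_gt0 mulr_gt0.
      - move: Ap Aq => [[/= + _] _] [[/= + _] _]; rewrite !in_itv/= => /andP[h1 h2] /andP[h3 h4].
        by rewrite ler_norml; apply/andP; split; lra.
      - exact: dist.
      - by apply: cyl_radius_dist (dist _ _ Ap0 Ap).
      - by apply: cyl_radius_dist (dist _ _ Ap0 Aq).
    by rewrite ler_wpM2r ?sqr_ge0// /K; lra.
  have [B [mB AB Bs]] := isodiametric c0 rc0 Ks0 As.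
  exists B; split => //; apply: le_trans Bs _.
  rewrite /cover_weight sE -!EFinM lee_fin exprMn sqr_sqrtr ?(ltW K0)//.
  by rewrite le_eqVlt; apply/orP; left; apply/eqP; field; rewrite !gt_eqF.
have [B BP] := choice hull.
have mB i : measurable (B i) by case: (BP i).
have rectB : rect `<=` \bigcup_i B i.
  move=> p rp; have [i _ Fi] : (\bigcup_i F i) (cyl_point p.1 p.2).
    apply: AF; exists (cyl_radius p.2 * cos p.1), (cyl_radius p.2 * sin p.1), p.2.
    move: rp => [_ /=]; rewrite in_itv/= => hab; split => //.
    have [hr _] := kapP _ hab; have := cyl_radius_sqr rho0 hr.
    by move=> cr; rewrite !exprMn -mulrDr cos2Dsin2 mulr1 cr subrK.
  by exists i => //; have [_ + _] := BP i; apply.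
have sub : (leb2 rect <= \sum_(i <oo) leb2 (B i))%E.
  exact: measure_sigma_subadditive.
rewrite mulrC EFinM -rectE.
apply: (@le_trans _ _ (rho%:E * \sum_(i <oo) ((K / rho)%:E * cover_weight F i))%E).
  rewrite lee_pmul2l//; apply: le_trans sub _.
  by apply: lee_nneseries => [i _ _|i _]; [exact: measure_ge0|case: (BP i)].
rewrite nneseriesZl; last by move=> i _; exact: cover_weight_ge0.
by rewrite muleA -EFinM mulrC divfK// gt_eqF.
Qed.

Lemma hausdorff2_zone_ge a b : - rho < a -> a <= b -> b < rho ->
  ((2 * pi * rho * (b - a))%:E <= hausdorff2 (zone a b))%E.
Proof.
move=> ra ab br; have [kap kap0 kapP] := cyl_radius_sqr_ge rho0 ra br.
have p0 := pi_gt0 R; have p2 := pihalf_ge1 R.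
have kapP' h : a <= h <= b -> - rho <= h <= rho /\ kap <= cyl_radius h.
  move=> /kapP[hr kh]; split => //.
  by rewrite -(@ler_pXn2r _ 2)// ?nnegrE ?sqrtr_ge0// ltW.
have [->|fA] := eqVneq (hausdorff2 (zone a b)) +oo%E; first exact: leey.
have {}fA : hausdorff2 (zone a b) \is a fin_num.
  by rewrite ge0_fin_numE ?hausdorff2_ge0// ltey.
rewrite -(fineK fA) lee_fin; set H := fine _.
have H0 : 0 <= H by rewrite fine_ge0// hausdorff2_ge0.
apply: (@ler_invnP _ _ _ (5 * H + 2 * (b - a) * rho)) => n.
set e := n.+1%:R^-1.
have e0 : 0 < e by rewrite invr_gt0.
have ele1 : e <= 1 by rewrite invf_le1// ler1n.
have se : 0 < sin e by rewrite sin_gt0_pi//; apply/andP; split => //; lra.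
have se1 : sin e <= 1 by exact: sin_le1.
(* Taking [delta = y kap] makes [delta / kap] at most [e], for the error term, and [y / 2 < sin e],
   for the seam. *)
pose y := e * sin e.
have y0 : 0 < y by rewrite mulr_gt0.
have ye : y <= e by rewrite ger_pMr.
have ys : y <= sin e by rewrite ger_pMl.
have yk : y * kap / (2 * kap) = y / 2 by field; rewrite gt_eqF.
have yk' : y * kap / kap = y by rewrite mulfK// gt_eqF.
have h : (((2 * pi - 2 * e) * (b - a) * rho)%:E <=
    (1 + 5 * y)%:E * hausdorff2_delta (y * kap) (zone a b))%E.
  have := @hausdorff2_delta_zone_ge a b e kap (y * kap) ab; rewrite yk yk'; apply => //.
  - by rewrite e0/=; lra.
  - by rewrite mulr_gt0//= ler_piMl//; lra.
  - by lra.
have {}h : ((2 * pi - 2 * e) * (b - a) * rho <= (1 + 5 * y) * H)%R.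
  rewrite -lee_fin (EFinM _ H) (fineK fA); apply: le_trans h _.
  rewrite lee_pmul2l//; last by rewrite lte_fin; lra.
  by apply: hausdorff2_ge; rewrite mulr_gt0.
have : y * H <= e * H by rewrite ler_wpM2r.
by rewrite -/e; lra.
Qed.

Lemma hausdorff2_zone_top a : - rho <= a <= rho ->
  hausdorff2 (zone a rho) = (2 * pi * rho * (rho - a))%:E.
Proof.
move=> arho; apply/eqP; rewrite eq_le (hausdorff2_zone_top_le xi orth rho0 arho)/=.
have fA : hausdorff2 (zone a rho) \is a fin_num.
  rewrite ge0_fin_numE ?hausdorff2_ge0//.
  by rewrite (le_lt_trans (hausdorff2_zone_top_le xi orth rho0 arho))// ltry.
move: arho => /andP[ra ar]; have p0 := pi_ge0 R.
rewrite -(fineK fA) lee_fin; set H := fine _.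
have H0 : 0 <= H by rewrite fine_ge0// hausdorff2_ge0.
apply: (@ler_invnP _ _ _ (4 * pi * rho)) => n.
set e := n.+1%:R^-1.
have e0 : 0 < e by rewrite invr_gt0.
have C0 : 0 <= 2 * pi * rho by rewrite !mulr_ge0// ltW.
(* Removing height [e] at both ends costs [4 pi rho e]. For a height at most [2 e] this cost is
   already at least the expected area, and the claim is trivial. *)
have [ae|ae] := leP (rho - a) (2 * e).
  have := ler_wpM2l C0 ae; lra.
have : ((2 * pi * rho * (rho - e - (a + e)))%:E <= hausdorff2 (zone a rho))%E.
  apply: (@le_trans _ _ (hausdorff2 (zone (a + e) (rho - e)))).
    by apply: hausdorff2_zone_ge; lra.
  apply: le_hausdorff2 => z [x [y [h [xyh /andP[h1 h2] ->]]]].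
  by exists x, y, h; split => //; apply/andP; split; lra.
rewrite -(fineK fA) lee_fin -/H; lra.
Qed.

End ZoneLower.

(** * Spherical caps *)

Section OrthonormalBasis.
Context {R : realType} {d : nat}.
Implicit Types (u v w : 'rV[R]_d) (V W : {vspace 'rV[R]_d}).

Lemma dotp_sqrD u v : dotp (u + v) (u + v) = dotp u u + dotp v v + 2 * dotp v u.
Proof. by rewrite !dotpDl !dotpDr (dotpC u v); ring. Qed.

Lemma enorm_normalize u (r : R) : 0 <= r -> u != 0 -> enorm ((r / enorm u) *: u) = r.
Proof.
move=> r0 u0; have nu : enorm u != 0.
  by rewrite -sqrf_eq0 enorm_sqr dotp_eq0.
apply/enorm_eq => //; rewrite dotpZl dotpZr -enorm_sqr; by field.
Qed.

(** One Gram-Schmidt step: some [w] in [V] lies outside the span of [s], and its component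
    orthogonal to [s] is normalized. *)
Lemma ex_orthogonal V (s : seq 'rV[R]_d) : uniq s -> {subset s <= V} ->
  {in s &, forall e f, dotp e f = (e == f)%:R} -> (size s < \dim V)%N ->
  exists2 e, e \in V & dotp e e = 1 /\ {in s, forall f, dotp e f = 0}.
Proof.
move=> us sV' orth sV.
have /subvPn[w wV ws] : ~~ (V <= span s)%VS.
  by apply: contraL sV => /dimvS h; rewrite -leqNgt (leq_trans h)// dim_span.
pose u := w - \sum_(e <- s) dotp w e *: e.
have uV : u \in V.
  rewrite memvB// big_seq memv_suml// => e es; rewrite memvZ// sV'//.
have u0 : u != 0.
  apply: contraNneq ws => /eqP; rewrite subr_eq0 => /eqP ->.
  by rewrite big_seq memv_suml// => e es; rewrite memvZ// memv_span.
have uorth f : f \in s -> dotp u f = 0.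
  move=> fs; rewrite /u dotpBl.
  have -> : dotp (\sum_(e <- s) dotp w e *: e) f = \sum_(e <- s) dotp w e * dotp e f.
    by elim/big_rec2: _ => [|e y z _ <-]; rewrite ?dotp0l// dotpDl dotpZl.
  rewrite (bigD1_seq f)//= (orth f f)// eqxx mulr1 big_seq_cond big1 ?addr0 ?subrr//.
  by move=> e /andP[es ef]; rewrite (orth e f)// (negbTE ef) mulr0.
exists ((1 / enorm u) *: u); first by rewrite memvZ.
split; last by move=> f fs; rewrite dotpZl uorth// mulr0.
by rewrite -enorm_sqr enorm_normalize ?expr1n.
Qed.

Lemma orthonormal3_basis V e1 e2 e3 : orthonormal3 e1 e2 e3 ->
  \dim V = 3%N -> e1 \in V -> e2 \in V -> e3 \in V ->
  forall w, w \in V -> exists x y h, w = x *: e1 + y *: e2 + h *: e3.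
Proof.
move=> [e11 e22 e33 [e12 e13 e23]] dV e1V e2V e3V w wV.
pose X := [tuple e1; e2; e3].
have fX : free X.
  apply/freeP => k; rewrite !big_ord_recl big_ord0 addr0/= => k0.
  have dot e : dotp (k ord0 *: e1 + (k (lift ord0 ord0) *: e2 +
      k (lift ord0 (lift ord0 ord0)) *: e3)) e = 0 by rewrite k0 dotp0l.
  have := dot e1; have := dot e2; have := dot e3.
  rewrite !dotpDl !dotpZl (dotpC e2 e1) (dotpC e3 e1) (dotpC e3 e2).
  rewrite e11 e22 e33 e12 e13 e23 !mulr0 !mulr1 !addr0 !add0r => k2 k1 k0'.
  case=> [[|[|[|//]]]] i3.
  - by rewrite -k0'; congr k; apply: val_inj.
  - by rewrite -k1; congr k; apply: val_inj.
  - by rewrite -k2; congr k; apply: val_inj.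
have XV : span X = V.
  apply/eqP; rewrite eqEdim dV (eqP fX) leqnn andbT.
  by apply/span_subvP => e; rewrite !inE => /or3P[] /eqP ->.
move: wV; rewrite -XV => /coord_span ->.
rewrite !big_ord_recl big_ord0 addr0/= addrA.
by do 3 eexists.
Qed.

Lemma ex_orthonormal3 V e3 : \dim V = 3%N -> e3 \in V -> dotp e3 e3 = 1 ->
  exists e1 e2, [/\ e1 \in V, e2 \in V & orthonormal3 e1 e2 e3].
Proof.
move=> dV e3V e33.
have [|||| e1 e1V [e11 e1o]] := @ex_orthogonal V [:: e3].
- by [].
- by move=> e; rewrite inE => /eqP ->.
- by move=> e f; rewrite !inE => /eqP -> /eqP ->; rewrite eqxx.
- by rewrite dV.
have e13 : dotp e1 e3 = 0 by apply: e1o; rewrite inE.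
have ne13 : e1 != e3.
  by apply: contra_eq_neq e13 => ->; rewrite e33 oner_eq0.
have [|||| e2 e2V [e22 e2o]] := @ex_orthogonal V [:: e1; e3].
- by rewrite /= inE ne13.
- by move=> e; rewrite !inE => /orP[] /eqP ->.
- move=> e f; rewrite !inE => /orP[] /eqP -> /orP[] /eqP ->; rewrite ?eqxx//.
    by rewrite (negbTE ne13).
  by rewrite dotpC eq_sym (negbTE ne13).
- by rewrite dV.
exists e1, e2; split => //; split => //; split => //.
- by rewrite dotpC; apply: e2o; rewrite !inE eqxx.
- by apply: e2o; rewrite !inE eqxx orbT.
Qed.

(** [is_2sphere] only asserts that some 3-plane exists. It is recovered from the sphere, since each
    nonzero [w] in [W] points from the center to a point of the sphere. *)
Lemma sphere_direction V W xi (rho : R) : 0 < rho -> \dim W = \dim V ->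
  [set z | affine_translate W xi z /\ enorm (z - xi) = rho] `<=` affine_translate V xi ->
  W = V.
Proof.
move=> rho0 dWV sub; apply/eqP; rewrite eqEdim dWV leqnn andbT.
apply/subvP => w wW; have [->|w0] := eqVneq w 0; first exact: mem0v.
have nw : enorm w != 0 by rewrite -sqrf_eq0 enorm_sqr dotp_eq0.
have : affine_translate V xi (xi + (rho / enorm w) *: w).
  apply: sub; rewrite /affine_translate/= addrAC subrr add0r; split.
    by rewrite memvZ.
  by rewrite enorm_normalize// ltW.
rewrite /affine_translate/= addrAC subrr add0r => /(memvZ (enorm w / rho)).
rewrite scalerA (_ : enorm w / rho * (rho / enorm w) = 1) ?scale1r//.
by field; rewrite nw gt_eqF.
Qed.

(* The spheres are translates of one another, so the ball meets each of them in
   a cap centered on the same direction. *)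
Lemma hausdorff2_sphere_ball V xi xi' v (rho r : R) : 0 < rho -> 0 <= r ->
  \dim V = 3%N -> v \in V -> enorm v = rho ->
  orthogonal_compl V xi -> orthogonal_compl V xi' ->
  hausdorff2 (closed_ball_ enorm (xi + v) r `&`
    [set z | affine_translate V xi' z /\ enorm (z - xi') = rho]) =
  (pi * Num.min (Num.max (r ^+ 2 - enorm (xi - xi') ^+ 2) 0) (4 * rho ^+ 2))%:E.
Proof.
move=> rho0 r0 dV vV vrho xiV xiV'.
pose e3 := rho^-1 *: v.
have vv : dotp v v = rho ^+ 2 by rewrite -enorm_sqr vrho.
have e33 : dotp e3 e3 = 1 by rewrite /e3 dotpZl dotpZr vv; field; rewrite gt_eqF.
have e3V : e3 \in V by rewrite memvZ.
have [e1 [e2 [e1V e2V orth]]] := ex_orthonormal3 dV e3V e33.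
have vE : v = rho *: e3 by rewrite scalerA mulfV ?scale1r// gt_eqF.
set D := enorm (xi - xi') ^+ 2.
have DE : D = dotp (xi - xi') (xi - xi') by rewrite /D enorm_sqr.
(* The squared distance from [xi + v] to a point of the sphere at height [h] is
   [D + 2 rho^2 - 2 rho h], at most [r^2] exactly when [h >= a]. *)
pose a := rho - (r ^+ 2 - D) / (2 * rho).
set A := _ `&` _.
have AE : A = zone xi' e1 e2 e3 rho a rho.
  have dist x y h : dotp (xi + v - frame_point xi' e1 e2 e3 x y h)
      (xi + v - frame_point xi' e1 e2 e3 x y h) =
      D + (rho ^+ 2 + (x ^+ 2 + y ^+ 2 + h ^+ 2) - 2 * rho * h).
    pose w := x *: e1 + y *: e2 + h *: e3.
    have wV : w \in V by rewrite !memvD ?memvZ.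
    have -> : xi + v - frame_point xi' e1 e2 e3 x y h = (xi - xi') + (v - w).
      by rewrite /frame_point -/w opprD addrACA.
    (* Displacements in [V] are orthogonal to [xi - xi'], so the distance of the centers enters as
       the plain summand [D]. *)
    have ort : dotp (v - w) (xi - xi') = 0.
      by rewrite dotpBr xiV ?xiV' ?subrr// memvB.
    rewrite dotp_sqrD ort mulr0 addr0 -DE; congr (_ + _).
    have -> : v - w = frame_point 0 e1 e2 e3 0 0 rho - frame_point 0 e1 e2 e3 x y h.
      by rewrite /frame_point !add0r !scale0r !add0r -vE.
    by rewrite frame_point_dist//; ring.
  have ball x y h : x ^+ 2 + y ^+ 2 + h ^+ 2 = rho ^+ 2 ->
      (enorm (xi + v - frame_point xi' e1 e2 e3 x y h) <= r) = (a <= h).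
    move=> xyh; rewrite enorm_le// dist xyh /a lerBlDr -lerBlDl ler_pdivlMr ?mulr_gt0//.
    by apply/idP/idP; lra.
  apply/seteqP; split => z.
    move=> [/= zb [zV zr]].
    have [x [y [h zE]]] := orthonormal3_basis orth dV e1V e2V e3V zV.
    have {}zE : z = frame_point xi' e1 e2 e3 x y h by rewrite /frame_point -zE addrC subrK.
    have xyh : x ^+ 2 + y ^+ 2 + h ^+ 2 = rho ^+ 2.
      move: zr => /enorm_eq => /(_ (ltW rho0)) <-.
      have -> : z - xi' = frame_point xi' e1 e2 e3 x y h - frame_point xi' e1 e2 e3 0 0 0.
        by rewrite zE /frame_point !scale0r !addr0.
      by rewrite frame_point_dist// !subr0.
    exists x, y, h; split => //.
    rewrite -(ball _ _ _ xyh) -zE zb/=.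
    rewrite (le_trans (ler_norm _))// -(@ler_pXn2r _ 2)// ?nnegrE ?(ltW rho0)//.
    by rewrite real_normK ?num_real// -xyh lerDr addr_ge0 ?sqr_ge0.
  move=> [x [y [h [xyh /andP[ah _] ->]]]]; split.
    by rewrite /closed_ball_/= ball.
  have E : frame_point xi' e1 e2 e3 x y h - xi' = x *: e1 + y *: e2 + h *: e3.
    by rewrite /frame_point addrAC subrr add0r.
  split; first by rewrite /affine_translate/= E !memvD ?memvZ.
  apply/enorm_eq; first exact: ltW.
  have -> : frame_point xi' e1 e2 e3 x y h - xi' =
      frame_point xi' e1 e2 e3 x y h - frame_point xi' e1 e2 e3 0 0 0.
    by rewrite {3}/frame_point !scale0r !addr0.
  by rewrite frame_point_dist// !subr0.
have aE : r ^+ 2 - D = 2 * rho * (rho - a) by rewrite /a; field; rewrite gt_eqF.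
rewrite AE aE.
(* The two clamps are the degenerate caps: empty for [a > rho], the whole sphere for [a < - rho].
   Otherwise the area is [2 pi rho (rho - a) = pi (r^2 - D)]. *)
have [ra|ra] := leP a rho; last first.
  rewrite max_r ?min_l ?mulr0; last 2 first.
  - by rewrite mulr_ge0 ?sqr_ge0.
  - by rewrite pmulr_rle0 ?mulr_gt0// subr_le0 ltW.
  rewrite (_ : zone _ _ _ _ _ _ _ = set0).
    apply/eqP; rewrite eq_le hausdorff2_ge0 andbT; apply: hausdorff2_le => delta d0.
    by rewrite hausdorff2_delta0// ltW.
  by rewrite -subset0 => z [x [y [h [_ /andP[h1 h2] _]]]]; move: ra; rewrite ltNge (le_trans h1).
rewrite max_l ?mulr_ge0 ?subr_ge0 ?(ltW rho0)//.
have [ar|ar] := leP (- rho) a.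
  rewrite min_l;
    last by rewrite (_ : 4 * rho ^+ 2 = 2 * rho * (rho + rho));
      [rewrite ler_pM2l ?mulr_gt0//; lra|ring].
  rewrite hausdorff2_zone_top//; last by rewrite ar.
  by congr EFin; ring.
rewrite min_r;
    last by rewrite (_ : 4 * rho ^+ 2 = 2 * rho * (rho + rho));
      [rewrite ler_pM2l ?mulr_gt0//; lra|ring].
rewrite (_ : zone _ _ _ _ _ _ _ = zone xi' e1 e2 e3 rho (- rho) rho).
  rewrite hausdorff2_zone_top//; last by rewrite lexx/=; lra.
  by congr EFin; ring.
apply/seteqP; split => z [x [y [h [xyh /andP[h1 h2] ->]]]]; exists x, y, h; split => //; last first.
  by rewrite (le_trans (ltW ar)).
rewrite h2 andbT.
have : `|h| <= rho.
  rewrite -(@ler_pXn2r _ 2)// ?nnegrE ?(ltW rho0)//.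
  by rewrite real_normK ?num_real// -xyh lerDr addr_ge0 ?sqr_ge0.
by rewrite ler_norml => /andP[].
Qed.

End OrthonormalBasis.

(** * Distance symmetry and the sum over the spheres *)

(** Distinct layers disagree at every point. By finiteness the map is then a permutation: seen from
    the center [j], each center belongs to exactly one layer. *)
Lemma layering_inj (N : nat) (l : 'I_N -> 'S_N) : layering l ->
  forall j, injective (fun i => l i j).
Proof.
move=> [_ _ l3 _] j i k lik; apply/eqP; apply: contraT => /eqP ik.
by have := l3 i k ik j; rewrite lik.
Qed.

(* Cap [i] contributes the increment of [min (r^2) (4 i rho^2)]. *)
Lemma sum_clamp (R : realType) (N : nat) (q s : R) : 0 <= q -> 0 <= s ->
  \sum_(i < N) Num.min (Num.max (q - i%:R * s) 0) s = Num.min q (N%:R * s).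
Proof.
move=> q0 s0; rewrite -(big_mkord xpredT (fun i => Num.min (Num.max (q - i%:R * s) 0) s)).
elim: N => [|n IH]; first by rewrite big_geq// mul0r min_r.
rewrite big_nat_recr//= IH -natr1 mulrDl mul1r.
have : 0 <= n%:R * s by rewrite mulr_ge0.
set x := n%:R * s => x0.
have [qx|qx] := leP q x.
  rewrite min_l; last by rewrite ge_max; lra.
  by rewrite max_r ?min_l; lra.
rewrite max_l; last by lra.
have [qs|qs] := leP (q - x) s; first by rewrite min_l; lra.
by rewrite min_r; lra.
Qed.

(** Some layer [i] carries [j] to [k]; it is not layer 0, which is the identity, so the distance is
    [2 sqrt i rho] with [i >= 1]. This gap keeps the spheres apart. *)
Lemma distance_symmetric_neq (R : realType) (d N : nat) (rho : R)
    (alpha : 'I_N -> 'rV[R]_d) (l : 'I_N -> 'S_N) : 0 < rho -> layering l ->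
  (forall i j : 'I_N, enorm (alpha j - alpha (l i j)) = 2 * Num.sqrt (i : nat)%:R * rho) ->
  forall j k, j != k -> 2 * rho <= enorm (alpha j - alpha k).
Proof.
move=> rho0 lay dist j k jk.
have [g _ gK] := injF_bij (layering_inj lay (j:=j)).
move: jk; rewrite -(gK k); set i := g k => jk.
have [l1 _ _ _] := lay.
have i0 : (0 < i)%N.
  by rewrite lt0n; apply: contraNneq jk => i0; rewrite l1.
rewrite dist ler_pM2r// ler_peMr// -[leLHS]sqrtr1 ler_wsqrtr//.
by rewrite ler1n.
Qed.

Lemma hausdorff2_distance_symmetric (R : realType) (d N : nat)
    (S : 'I_N -> set 'rV[R]_d) (xi : 'I_N -> 'rV[R]_d) (V : {vspace 'rV[R]_d}) :
  (0 < N)%N ->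
  (forall i, is_2sphere (S i) (xi i) (1 / Num.sqrt N%:R)) ->
  \dim V = 3%N ->
  (forall i, S i `<=` affine_translate V (xi i) /\ orthogonal_compl V (xi i)) ->
  distance_symmetric N (range xi) ->
  forall (x : 'rV[R]_d) (r : R), (\bigcup_(i in [set: 'I_N]) S i) x -> 0 <= r <= 2 ->
    hausdorff2 (closed_ball_ enorm x r `&` \bigcup_(i in [set: 'I_N]) S i) =
    (pi * r ^+ 2)%:E.
Proof.
move=> N0 Ssphere dV SV [alpha [xi_alpha [l [lay dist]]]] x r [j _ Sjx] /andP[r0 r2].
set rho : R := 1 / Num.sqrt N%:R in Ssphere dist *.
have rho0 : 0 < rho by rewrite divr_gt0// sqrtr_gt0 ltr0n.
have rho2 : rho ^+ 2 = N%:R^-1 by rewrite expr_div_n expr1n sqr_sqrtr// mul1r.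
have SE i : S i = [set z | affine_translate V (xi i) z /\ enorm (z - xi i) = rho].
  have [W [dW WE]] := Ssphere i.
  suff <- : W = V by [].
  apply: (@sphere_direction _ _ _ _ (xi i) rho) => //; first by rewrite dW dV.
  by have [+ _] := SV i; rewrite WE.
have xiV i : orthogonal_compl V (xi i) by case: (SV i).
have alpha_sep := distance_symmetric_neq rho0 lay dist.
have alpha_inj : injective alpha.
  move=> i k ajk; apply/eqP; apply: contraT => /alpha_sep.
  rewrite ajk subrr /enorm dotp0l sqrtr0; lra.
(* Distance symmetry concerns the set of centers, with an enumeration [alpha] of its own; [tau]
   matches it with [xi]. As [alpha] is injective, [tau] is a bijection and the [xi i] are pairwise
   distinct too. *)
have /choice[tau tauE] : forall k, exists k', xi k' = alpha k.
  move=> k; have : range xi (alpha k) by rewrite xi_alpha; exists k.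
  by move=> [k' _ <-]; exists k'.
have tau_inj : injective tau.
  by move=> i k tik; apply: alpha_inj; rewrite -!tauE tik.
have [tau' tau'K tauK] := injF_bij tau_inj.
have xi_sep i k : i != k -> 2 * rho <= enorm (xi i - xi k).
  move=> ik; rewrite -(tauK i) -(tauK k) !tauE; apply: alpha_sep.
  by apply: contra_neq ik => h; rewrite -(tauK i) -(tauK k) h.
move: (Sjx); rewrite SE => -[xV xr].
pose v := x - xi j; have xE : x = xi j + v by rewrite addrC subrK.
have [i0 i0E] : exists i0, tau i0 = j by exists (tau' j).
rewrite setI_bigcupr.
rewrite (@hausdorff2_bigU_separated _ _ (2 * rho)); first last.
- move=> i k y z ik [_ +] [_ +]; rewrite !SE => -[yV _] [zV _].
  apply: le_trans (xi_sep _ _ ik) _.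
  rewrite enorm_le ?enorm_ge0// enorm_sqr.
  (* The component of [y - z] orthogonal to [V] is the difference of the centers. *)
  have -> : y - z = (xi i - xi k) + ((y - xi i) - (z - xi k)).
    by apply/rowP => t; rewrite !mxE; ring.
  have ort : dotp ((y - xi i) - (z - xi k)) (xi i - xi k) = 0.
    by rewrite dotpBr !xiV ?subrr// memvB.
  rewrite [leRHS]dotp_sqrD ort mulr0 addr0 lerDl.
  exact: dotp_ge0.
- by rewrite mulr_gt0.
have cap k : hausdorff2 (closed_ball_ enorm x r `&` S k) =
    (pi * Num.min (Num.max (r ^+ 2 - enorm (xi j - xi k) ^+ 2) 0) (4 * rho ^+ 2))%:E.
  by rewrite SE xE hausdorff2_sphere_ball// ltW.
under eq_bigr do rewrite cap.
rewrite sumEFin -mulr_sumr; congr (_ * _)%:E.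
(* The sum passes from spheres to the enumeration [alpha], then to the layers seen from the center
   of the sphere through [x], where the squared distance is [4 i rho^2]. *)
rewrite (reindex_inj tau_inj) (reindex_inj (layering_inj lay (j:=i0)))/=.
rewrite (eq_bigr (fun i : 'I_N =>
    Num.min (Num.max (r ^+ 2 - i%:R * (4 * rho ^+ 2)) 0) (4 * rho ^+ 2))); last first.
  move=> i _; rewrite -i0E !tauE dist.
  rewrite (_ : (2 * Num.sqrt i%:R * rho) ^+ 2 = i%:R * (4 * rho ^+ 2))//.
  by rewrite !exprMn sqr_sqrtr//; ring.
rewrite sum_clamp ?sqr_ge0 ?mulr_ge0 ?sqr_ge0//.
(* The upper clamp is [4 N rho^2 = 4], and [r <= 2] makes [r^2] the minimum. *)
rewrite rho2 mulrCA divff ?mulr1 ?pnatr_eq0 -?lt0n// min_l//.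
have : r ^+ 2 <= 2 ^+ 2 by rewrite ler_pXn2r ?nnegrE.
lra.
Qed.

Theorem theorem3p9 (R : realType) (d m : nat) (Omega : set 'rV[R]_d)
    (S : 'I_(2 * m) -> set 'rV[R]_d) (xi : 'I_(2 * m) -> 'rV[R]_d)
    (V : {vspace 'rV[R]_d})
    (sigma := restriction hausdorff2 Omega) :
  Omega `<=` unit_sphere ->
  (1 <= m)%N ->
  Omega = \bigcup_(i in [set: 'I_(2 * m)]) S i ->
  (forall i, is_2sphere (S i) (xi i) (1 / Num.sqrt (2 * m)%:R)) ->
  \dim V = 3%N ->
  (forall i, S i `<=` affine_translate V (xi i) /\ orthogonal_compl V (xi i)) ->
  distance_symmetric (2 * m) (range xi) ->
  forall (x : 'rV[R]_d) (r : R), Omega x -> 0 <= r <= 2 ->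
    sigma (closed_ball_ enorm x r) = (pi * r ^+ 2)%:E.
Proof.
move=> _ m1 OmegaE Ssphere dV SV dsym x r Ox rle; rewrite /sigma /restriction OmegaE.
apply: hausdorff2_distance_symmetric Ssphere dV SV dsym _ _ _ rle.
  by rewrite muln_gt0.
by rewrite -OmegaE.
Qed.
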